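(* Let $A=(A_N)_{N\in\mathbb N}$ and $B=(B_N)_{N\in\mathbb N}$ be two random matrix ensembles of $N\times N$ random matrices which are asymptotically free of second order. Then for all $m,n\ge 1$ $$\kappa_n^{A+B}=\kappa_n^{A}+\kappa_n^{B}\qquad\text{and}\qquad \kappa_{m,n}^{A+B}=\kappa_{m,n}^A+\kappa_{m,n}^B .$$ Alternatively, $$\mathcal R^{A+B}(x)=\mathcal R^A(x)+\mathcal R^B(x)\qquad\text{and}\qquad \mathcal R^{A+B}(x,y)=\mathcal R^A(x,y)+\mathcal R^B(x,y).$$
   Context: The random matrices are complex, and their entries have moments of all orders. $\mathrm{Tr}$ is the unnormalized trace and $\mathrm{tr}=\frac1N\mathrm{Tr}$; $k_n$ is the $n$-th classical cumulant ($k_1$ is the expectation, $k_2(X,Y)=E[XY]-E[X]E[Y]$ the covariance). An ensemble $A=(A_N)_{N\in\mathbb N}$ has a second order limit distribution if for all $m,n\ge1$ the limits $\alpha^A_n:=\lim_{N\to\infty} k_1(\mathrm{tr}(A_N^n))$ and $\alpha^A_{m,n}:=\lim_{N\to\infty} k_2(\mathrm{Tr}(A_N^m),\mathrm{Tr}(A_N^n))$ exist, and $\lim_{N\to\infty} k_r(\mathrm{Tr}(A_N^{n(1)}),\dots,\mathrm{Tr}(A_N^{n(r)}))=0$ for all $r\ge3$ and all $n(1),\dots,n(r)\ge1$. Asymptotic freeness of second order: let $A$ and $B$ each have a second order limit distribution, and denote by $Y_N(n(1),m(1),\dots,n(p),m(p))$ the random variable $$\mathrm{Tr}\bigl((A_N^{n(1)}-\alpha^A_{n(1)}1)(B_N^{m(1)}-\alpha^B_{m(1)}1)\cdots(A_N^{n(p)}-\alpha^A_{n(p)}1)(B_N^{m(p)}-\alpha^B_{m(p)}1)\bigr).$$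 $A$ and $B$ are asymptotically free of second order if for all $n,m\ge1$ $$\lim_{N\to\infty} k_2\bigl(\mathrm{Tr}(A_N^n-\alpha^A_n1),\mathrm{Tr}(B_N^m-\alpha^B_m1)\bigr)=0$$ and for all $p,q\ge1$ and all $n(1),\dots,n(p),m(1),\dots,m(p),\tilde n(1),\dots,\tilde n(q),\tilde m(1),\dots,\tilde m(q)\ge1$ we have $$\lim_{N\to\infty} k_2\bigl(Y_N(n(1),m(1),\dots,n(p),m(p)),\,Y_N(\tilde n(1),\tilde m(1),\dots,\tilde n(q),\tilde m(q))\bigr)=0$$ if $p\ne q$, and otherwise (counting the arguments of the indices modulo $p$, i.e. $n(i+p)=n(i)$) $$\lim_{N\to\infty} k_2\bigl(Y_N(n(1),m(1),\dots,n(p),m(p)),\,Y_N(\tilde n(p),\tilde m(p),\dots,\tilde n(1),\tilde m(1))\bigr)=\sum_{k=1}^p\prod_{i=1}^p\bigl(\alpha^A_{n(i+k)+\tilde n(i)}-\alpha^A_{n(i+k)}\alpha^A_{\tilde n(i)}\bigr)\bigl(\alpha^B_{m(i+k)+\tilde m(i+1)}-\alpha^B_{m(i+k)}\alpha^B_{\tilde m(i+1)}\bigr).$$ Free cumulants: given first and second order limit moments $(\alpha_n)_{n\ge1}$ and $(\alpha_{m,n})_{m,n\ge1}$, put $M(x)=1+\sum_{n\ge1}\alpha_nx^n$ and $M(x,y)=\sum_{m,n\ge1}\alpha_{m,n}x^my^n$. The first and second order free cumulants $(\kappa_n)_{n\ge1}$ and $(\kappa_{m,n})_{m,n\ge1}$,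 with generating series $C(x)=1+\sum_{n\ge1}\kappa_nx^n$ and $C(x,y)=\sum_{m,n\ge1}\kappa_{m,n}x^my^n$, are defined by the formal power series relations $C(xM(x))=M(x)$ and $$M(x,y)=C\bigl(xM(x),yM(y)\bigr)\cdot\frac{\frac d{dx}(xM(x))}{M(x)}\cdot\frac{\frac d{dy}(yM(y))}{M(y)}+xy\Bigl(\frac{\frac d{dx}(xM(x))\cdot\frac d{dy}(yM(y))}{(xM(x)-yM(y))^2}-\frac1{(x-y)^2}\Bigr).$$ The first order $R$-transform $\mathcal R(x)$ is defined by $C(x)=1+x\mathcal R(x)$ and the second order one by $\mathcal R(x,y)=\frac1{xy}C(x,y)$. Superscripts $A$, $B$, $A+B$ indicate that the limit moments of $(A_N)$, $(B_N)$, $(A_N+B_N)$ respectively are used; asymptotic freeness of second order is taken to imply that $A+B=(A_N+B_N)_{N\in\mathbb N}$ again has a second order limit distribution.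
   Formalization: Asymptotic freeness of second order is taken to include also that E[tr Y_N] → 0 (first order freeness) and that the covariances of Tr(A_N^k − α^A_k 1) and of Tr(B_N^k − α^B_k 1) with every Y_N tend to 0; without these the claim fails. *)

(* Defs.v *)
From HB Require Import structures.
From mathcomp Require Import all_boot all_order all_algebra complex fraction.
From mathcomp Require Import all_classical all_reals all_analysis.

Set Implicit Arguments.
Unset Strict Implicit.
Unset Printing Implicit Defensive.

Import Order.TTheory GRing.Theory Num.Theory.
Import numFieldNormedType.Exports.

Local Open Scope classical_set_scope.
Local Open Scope ring_scope.

(** [f n] is the coefficient of [x^n] in [f : fps R].  Bivariate series are
    iterated: for [F : fps (fps R)], [F m n] is the coefficient of [x^m y^n]. *)

Record fps (R : Type) := FPS { fps_coef :> nat -> R }.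

HB.instance Definition _ (R : Type) := gen_eqMixin (fps R).
HB.instance Definition _ (R : Type) := gen_choiceMixin (fps R).

Lemma fpsP (R : Type) (f g : fps R) : f =1 g -> f = g.
Proof. by case: f g => [f] [g] /= /funext ->. Qed.

Section FpsZmodule.
Variable R : zmodType.
Implicit Types f g h : fps R.

Definition fps_zero : fps R := FPS (fun=> 0).
Definition fps_opp f : fps R := FPS (fun n => - f n).
Definition fps_add f g : fps R := FPS (fun n => f n + g n).

Fact fps_addA : associative fps_add.
Proof. by move=> f g h; apply: fpsP => n /=; rewrite addrA. Qed.

Fact fps_addC : commutative fps_add.
Proof. by move=> f g; apply: fpsP => n /=; rewrite addrC. Qed.

Fact fps_add0 : left_id fps_zero fps_add.
Proof. by move=> f; apply: fpsP => n /=; rewrite add0r. Qed.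

Fact fps_addN : left_inverse fps_zero fps_opp fps_add.
Proof. by move=> f; apply: fpsP => n /=; rewrite addNr. Qed.

HB.instance Definition _ :=
  GRing.isZmodule.Build (fps R) fps_addA fps_addC fps_add0 fps_addN.

Lemma fps_coef0 n : (0 : fps R) n = 0. Proof. by []. Qed.
Lemma fps_coefD f g n : (f + g) n = f n + g n. Proof. by []. Qed.
Lemma fps_coefN f n : (- f) n = - f n. Proof. by []. Qed.
Lemma fps_coefB f g n : (f - g) n = f n - g n. Proof. by []. Qed.

End FpsZmodule.

Section FpsRing.
Variable R : comNzRingType.
Implicit Types f g h : fps R.

Definition fps_one : fps R := FPS (fun n => (n == 0)%:R).
Definition fps_mul f g : fps R :=
  FPS (fun n => \sum_(i < n.+1) f i * g (n - i)%N).

Let trunc (N : nat) f : {poly R} := \poly_(i < N) f i.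

Let fps_mul_trunc N f g n : (n < N)%N ->
  fps_mul f g n = (trunc N f * trunc N g)`_n.
Proof.
move=> nN; rewrite coefM /=; apply: eq_bigr => i _.
have iN : (i < N)%N by apply: leq_ltn_trans nN; rewrite -ltnS.
by rewrite !coef_poly iN (leq_ltn_trans (leq_subr _ _) nN).
Qed.

Fact fps_mulC : commutative fps_mul.
Proof.
by move=> f g; apply: fpsP => n; rewrite !(@fps_mul_trunc n.+1) // mulrC.
Qed.

Fact fps_mulA : associative fps_mul.
Proof.
have aux N (p q : {poly R}) f n : (n < N)%N ->
    (forall k, (k < N)%N -> p`_k = f k) -> (p * q)`_n = (trunc N f * q)`_n.
  move=> nN pf; rewrite !coefM; apply: eq_bigr => i _.
  have iN : (i < N)%N by apply: leq_ltn_trans nN; rewrite -ltnS.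
  by rewrite pf // coef_poly iN.
move=> f g h; apply: fpsP => n; rewrite !(@fps_mul_trunc n.+1) //.
rewrite mulrC -(@aux n.+1 (trunc n.+1 g * trunc n.+1 h) _ (fps_mul g h)) //;
  last by move=> k kn; rewrite (@fps_mul_trunc n.+1).
rewrite -(@aux n.+1 (trunc n.+1 f * trunc n.+1 g) _ (fps_mul f g)) //;
  last by move=> k kn; rewrite (@fps_mul_trunc n.+1).
by rewrite mulrC mulrA.
Qed.

Fact fps_mul1 : left_id fps_one fps_mul.
Proof.
move=> f; apply: fpsP => n /=; rewrite big_ord_recl /= mul1r subn0.
by rewrite big1 ?addr0 // => i _; rewrite mul0r.
Qed.

Fact fps_mulDl : left_distributive fps_mul +%R.
Proof.
move=> f g h; apply: fpsP => n /=.
by rewrite -big_split /=; apply: eq_bigr => i _; rewrite mulrDl.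
Qed.

Fact fps_one_neq0 : fps_one != 0.
Proof.
by apply/eqP => /(congr1 (fun f : fps R => f 0)) /eqP; rewrite oner_eq0.
Qed.

HB.instance Definition _ := GRing.Zmodule_isComNzRing.Build (fps R)
  fps_mulA fps_mulC fps_mul1 fps_mulDl fps_one_neq0.

Lemma fps_coef1 n : (1 : fps R) n = (n == 0)%:R. Proof. by []. Qed.
Lemma fps_coefM f g n : (f * g) n = \sum_(i < n.+1) f i * g (n - i)%N.
Proof. by []. Qed.

End FpsRing.

Section FpsIdomain.
Variable R : idomainType.
Implicit Types f g h : fps R.

Definition fps_unit : {pred fps R} := fun f => `[< exists g, g * f = 1 >].
Definition fps_inv f : fps R :=
  if pselect (exists g, g * f = 1) is left gf then projT1 (cid gf) else f.

Fact fps_mulVf : {in fps_unit, left_inverse 1 fps_inv *%R}.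
Proof.
move=> f; rewrite unfold_in => /asboolP fU; rewrite /fps_inv.
by case: pselect => // gf; case: cid.
Qed.

Fact fps_unitPl f g : g * f = 1 -> fps_unit f.
Proof. by move=> gf; apply/asboolP; exists g. Qed.

Fact fps_inv_out : {in [predC fps_unit], fps_inv =1 id}.
Proof.
move=> f; rewrite inE /= unfold_in => /asboolPn fU.
by rewrite /fps_inv; case: pselect.
Qed.

HB.instance Definition _ := GRing.ComNzRing_hasMulInverse.Build (fps R)
  fps_mulVf fps_unitPl fps_inv_out.

Lemma fps_neq0_min f : f != 0 ->
  exists2 n, f n != 0 & forall k, (k < n)%N -> f k = 0.
Proof.
move=> f0; have ex : exists n, f n != 0.
  apply: contrapT => /forallNP nf; case/eqP: f0; apply: fpsP => n.
  by apply/eqP; have /negP := nf n; rewrite negbK.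
exists (ex_minn ex); first by case: ex_minnP.
case: ex_minnP => m _ min_m k km; apply/eqP; apply/negPn/negP => /min_m.
by rewrite leqNgt km.
Qed.

Fact fps_idomain : GRing.integral_domain_axiom (fps R).
Proof.
move=> f g fg0; apply/norP => -[/fps_neq0_min[m fm mP] /fps_neq0_min[n gn nP]].
have : (f * g) (m + n)%N = 0 by rewrite fg0.
have mmn : (m < (m + n).+1)%N by rewrite ltnS leq_addr.
rewrite fps_coefM (bigD1 (Ordinal mmn)) //= addKn big1 => [|i im].
  by move/eqP; rewrite addr0 mulf_eq0 (negbTE fm) (negbTE gn).
have [im'|mi] := ltnP i m; first by rewrite mP // mul0r.
rewrite [X in _ * X]nP ?mulr0 // ltn_subLR; last by rewrite -ltnS.
by rewrite ltn_add2r ltn_neqAle mi andbT eq_sym.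
Qed.

HB.instance Definition _ := GRing.ComUnitRing_isIntegral.Build (fps R)
  fps_idomain.

End FpsIdomain.

Section FpsOps.
Variable R : comNzRingType.
Implicit Types f g : fps R.

Definition fpsX : fps R := FPS (fun n => (n == 1)%:R).

Definition fps_deriv f : fps R := FPS (fun n => f n.+1 *+ n.+1).

(** [C(g(x))] and [F(f(x), g(y))], for series [f], [g] without constant term:
    then only finitely many terms contribute to each coefficient. *)
Definition fps_comp (C g : fps R) : fps R :=
  FPS (fun k => \sum_(n < k.+1) C n * (g ^+ n) k).

Definition fps_comp2 (F : fps (fps R)) f g : fps (fps R) :=
  FPS (fun i => FPS (fun j =>
    \sum_(m < i.+1) \sum_(n < j.+1) F m n * (f ^+ m) i * (g ^+ n) j)).

(** [f(x)] and [f(y)] as bivariate series. *)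
Definition fps_inx f : fps (fps R) :=
  FPS (fun m => FPS (fun n => if n == 0 then f m else 0)).
Definition fps_iny f : fps (fps R) :=
  FPS (fun m => FPS (fun n => if m == 0 then f n else 0)).

Lemma fps_mulXE f n : (fpsX * f) n = if n is n'.+1 then f n' else 0.
Proof.
rewrite fps_coefM; case: n => [|n]; first by rewrite big_ord1 mul0r.
rewrite 2!big_ord_recl /= mul0r add0r mul1r subSS subn0 big1 ?addr0 // => i _.
by rewrite mul0r.
Qed.

Lemma fps_mulinxX (F : fps (fps R)) m n :
  (fps_inx fpsX * F) m n = if m is m'.+1 then F m' n else 0.
Proof.
have -> : fps_inx fpsX = FPS (fun n => (n == 1)%:R).
  apply: fpsP => k; apply: fpsP => l /=.
  by case: k => [|[|k]] /=; case: l.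
have -> : FPS (fun n => (n == 1)%:R) * F =
          FPS (fun m => if m is m'.+1 then F m' else 0).
  apply: fpsP => k; rewrite fps_coefM; case: k => [|k].
    by rewrite big_ord1 mul0r.
  rewrite 2!big_ord_recl /= mul0r add0r mul1r subSS subn0 big1 ?addr0 // => i _.
  by rewrite mul0r.
by case: m.
Qed.

Lemma fps_mulinyX (F : fps (fps R)) m n :
  (fps_iny fpsX * F) m n = if n is n'.+1 then F m n' else 0.
Proof.
have -> : (fps_iny fpsX * F) m = fpsX * F m.
  rewrite fps_coefM big_ord_recl /= subn0 big1 ?addr0 => [|i _].
    by congr (_ * _); apply: fpsP.
  by rewrite (_ : FPS _ = 0) ?mul0r //; apply: fpsP.
exact: fps_mulXE.
Qed.

End FpsOps.

Arguments fpsX {R}.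

(** Moment and cumulant sequences are indexed from [1]: their values at index
    [0] are ignored. *)

Section FreeCumulants.
Variable K : fieldType.
Implicit Types a kappa : nat -> K.

Definition series1 a : fps K := FPS (fun n => if n == 0 then 1 else a n).

Definition series2 (a2 : nat -> nat -> K) : fps (fps K) :=
  FPS (fun m => FPS (fun n => if (m == 0) || (n == 0) then 0 else a2 m n)).

Local Notation "f %:F" := (tofrac f).

Definition free_cumulants1 a kappa : Prop :=
  fps_comp (series1 kappa) (fpsX * series1 a) = series1 a.

(** The relation involves denominators in [x - y], which are not invertible
    power series: it is an equation in the fraction field of [K[[x, y]]]. *)
Definition free_cumulants2 a (a2 kappa2 : nat -> nat -> K) : Prop :=
  let x := (fps_inx fpsX)%:F in
  let y := (fps_iny fpsX)%:F in
  let M := series1 a in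
  let g := fpsX * M in
  let Mx := (fps_inx M)%:F in
  let My := (fps_iny M)%:F in
  let gx := (fps_inx g)%:F in
  let gy := (fps_iny g)%:F in
  let dgx := (fps_inx (fps_deriv g))%:F in
  let dgy := (fps_iny (fps_deriv g))%:F in
  (series2 a2)%:F =
    (fps_comp2 (series2 kappa2) g g)%:F * (dgx / Mx) * (dgy / My)
    + x * y * (dgx * dgy / (gx - gy) ^+ 2 - 1 / (x - y) ^+ 2).

Definition Rtransform1 kappa : fps K := FPS (fun n => kappa n.+1).

Definition Rtransform2 (kappa2 : nat -> nat -> K) : fps (fps K) :=
  FPS (fun m => FPS (fun n => kappa2 m.+1 n.+1)).

Lemma series1_Rtransform kappa :
  series1 kappa = 1 + fpsX * Rtransform1 kappa.
Proof.
apply: fpsP => n; rewrite fps_coefD fps_mulXE.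
by case: n => [|n] /=; rewrite ?addr0 ?add0r.
Qed.

Lemma series2_Rtransform (kappa2 : nat -> nat -> K) :
  series2 kappa2 = fps_inx fpsX * (fps_iny fpsX * Rtransform2 kappa2).
Proof.
apply: fpsP => m; apply: fpsP => n; rewrite fps_mulinxX.
by case: m => [|m] //; rewrite fps_mulinyX; case: n.
Qed.

End FreeCumulants.

(** The complex numbers, typed so that the topology of [numFieldType]s is
    inferred. *)
Definition cplx (R : realType) : numFieldType := R[i].

Section Cumulants.
Context d (T : measurableType d) (R : realType) (P : probability T R).
Implicit Types X Y : T -> cplx R.

Definition has_all_moments X : Prop :=
  forall k : nat, (1 <= k)%N ->
    (fun w => complex.Re (X w)) \in Lfun P k%:R%:E /\
    (fun w => complex.Im (X w)) \in Lfun P k%:R%:E.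

Definition cE X : cplx R :=
  (fine 'E_P[fun w => complex.Re (X w)] +i*
   fine 'E_P[fun w => complex.Im (X w)])%C.

Definition cCov X Y : cplx R := cE (fun w => X w * Y w) - cE X * cE Y.

Definition cumulant (r : nat) (X : 'I_r -> T -> cplx R) : cplx R :=
  \sum_(pi : {set {set 'I_r}} | finset.partition pi finset.setT)
    (-1) ^+ #|pi|.-1 * (#|pi|.-1)`!%:R *
    \prod_(V in pi) cE (fun w => \prod_(i in V) X i w).

End Cumulants.

Section Ensembles.
Context (R : realType) (d : nat -> measure_display)
  (T : forall N, measurableType (d N)) (P : forall N, probability (T N) R).
Local Notation C := (cplx R).

Definition ensemble := forall N, T N -> 'M[C]_N.

Implicit Types A B : ensemble.

Definition random_matrices A : Prop :=
  forall N i j, has_all_moments (P N) (fun w => A N w i j).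

Definition ensemble_add A B : ensemble := fun N w => A N w + B N w.

Definition Tr_pow A n N : T N -> C := fun w => \tr (A N w ^+ n).

Definition moment_seq A n : nat -> C :=
  fun N => cE (P N) (fun w => N%:R^-1 * Tr_pow A n w).
Definition cov_seq A m n : nat -> C :=
  fun N => cCov (P N) (Tr_pow A m (N := N)) (Tr_pow A n (N := N)).

Definition alpha A n : C := limn (moment_seq A n).
Definition alpha2 A m n : C := limn (cov_seq A m n).

Record second_order_limit A : Prop := {
  sol_moment : forall n, (1 <= n)%N -> cvgn (moment_seq A n);
  sol_cov : forall m n, (1 <= m)%N -> (1 <= n)%N -> cvgn (cov_seq A m n);
  sol_higher : forall r (n : 'I_r -> nat), (3 <= r)%N ->
    (forall i, 1 <= n i)%N ->
    cumulant (P N) (fun i => Tr_pow A (n i) (N := N)) @[N --> \oo] --> (0 : C)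
}.

Definition centered_pow A n N : T N -> 'M[C]_N :=
  fun w => A N w ^+ n - (alpha A n)%:M.

(** Index sequences are [0]-based: only [n 0, ..., n (p - 1)] and
    [m 0, ..., m (p - 1)] matter. *)
Definition alternating A B p (n m : nat -> nat) N : T N -> C :=
  fun w => \tr (\prod_(i < p)
    (centered_pow A (n i) w * centered_pow B (m i) w)).

Definition rev_index p (n : nat -> nat) : nat -> nat := fun i => n (p.-1 - i)%N.

Definition pos_seq (n : nat -> nat) : Prop := forall i, (1 <= n i)%N.

(** These second order conditions do not imply [asymptotically_free] or
    [asymptotically_uncorrelated] below.  With [Ia] a direct sum of copies of
    the [2 x 2] matrix unit [E12], and [Ib] its transpose, the deterministic
    pair [A = Ia], [B = Ib] violates the former; for [z] a standard circular
    complex Gaussian, [A = (z/N) 1 + Ia], [B = (2 conj z / N) Ib] violates the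
    latter.  In both cases the free cumulants of [A + B] are not the sums of
    those of [A] and [B]. *)
Record asymptotically_free2 A B : Prop := {
  af2_limA : second_order_limit A;
  af2_limB : second_order_limit B;
  af2_single : forall n m, (1 <= n)%N -> (1 <= m)%N ->
    cCov (P N) (fun w => \tr (centered_pow A n w))
               (fun w => \tr (centered_pow B m w)) @[N --> \oo] --> (0 : C);
  af2_neq : forall p q n m n' m', (1 <= p)%N -> (1 <= q)%N -> p != q ->
    pos_seq n -> pos_seq m -> pos_seq n' -> pos_seq m' ->
    cCov (P N) (alternating A B p n m (N := N))
               (alternating A B q n' m' (N := N)) @[N --> \oo] --> (0 : C);
  af2_eq : forall p n m n' m', (1 <= p)%N ->
    pos_seq n -> pos_seq m -> pos_seq n' -> pos_seq m' ->
    cCov (P N) (alternating A B p n m (N := N))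
               (alternating A B p (rev_index p n') (rev_index p m') (N := N))
      @[N --> \oo] -->
    (\sum_(k < p) \prod_(i < p)
       ((alpha A (n ((i + k) %% p) + n' i)%N
         - alpha A (n ((i + k) %% p)%N) * alpha A (n' i))
      * (alpha B (m ((i + k) %% p) + m' (i.+1 %% p))%N
         - alpha B (m ((i + k) %% p)%N) * alpha B (m' (i.+1 %% p)%N))) : C)
}.

Definition asymptotically_free A B : Prop :=
  forall p n m, (1 <= p)%N -> pos_seq n -> pos_seq m ->
    cE (P N) (fun w => N%:R^-1 * alternating A B p n m w) @[N --> \oo]
      --> (0 : C).

Definition asymptotically_uncorrelated A B : Prop :=
  forall k p n m, (1 <= k)%N -> (1 <= p)%N -> pos_seq n -> pos_seq m ->
    cCov (P N) (fun w => \tr (centered_pow A k w))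
               (alternating A B p n m (N := N)) @[N --> \oo] --> (0 : C) /\
    cCov (P N) (fun w => \tr (centered_pow B k w))
               (alternating A B p n m (N := N)) @[N --> \oo] --> (0 : C).

End Ensembles.

(* Main.v *)
(** Let [C] be the first order cumulant series of an ensemble [a] and put
    [U(t) = (C(t) - t a)^-1], a resolvent normalized so that [E tr U -> 1].
    If [V(t)] is the resolvent of [b], and [S(t)] that of [a + b] for the series
    [CA + CB - 1], then with [u = U - 1] and [v = V - 1]
<<
      1 - u v = U (U^-1 + V^-1 - 1) V = U S^-1 V.
>>
    Taking logarithmic derivatives of determinants,
    [tr ((S^-1)' S) = tr ((U^-1)' U) + tr ((V^-1)' V) - sum_p (tr (u v)^p)' / p],
    where [u] and [v] are series in centered powers, so that [tr (u v)^p] is made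
    of alternating traces.  In expectation these vanish, which says that
    [CA + CB - 1] is the cumulant series of [a + b].  In covariance, only
    [cov (tr (u_t v_t)^p, tr (u_s v_s)^p) -> p (X Y)^p] contributes, where
    [X = E tr (u_t u_s)] and [Y = E tr (v_t v_s)]; this adds the term
    [- d^2/dtds log (1 - X Y)].  Writing [h = t / C(t)], the function
    [H(t, s) = C(t) C(s) (h(t) - h(s))] satisfies [1 + X = (t - s) / HA], whence
    [1 - X Y = (t - s) H / (HA HB)], and the defining relation of the second
    order cumulants at [x = h(t)], [y = h(s)] says that [R(t, s)] is the
    covariance series plus [d^2/dtds log (H / (t - s))]: so [R] is additive. *)

Require Import Defs.
From HB Require Import structures.
From mathcomp Require Import all_boot all_order all_algebra.
From mathcomp Require Import complex fraction ring.
From mathcomp Require Import all_classical all_reals all_analysis.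
From mathcomp Require Import measurable_realfun.

Set Implicit Arguments.
Unset Strict Implicit.
Unset Printing Implicit Defensive.

Import Order.TTheory GRing.Theory Num.Theory.
Import numFieldNormedType.Exports.

Local Open Scope classical_set_scope.
Local Open Scope ring_scope.

(** * Power series and substitution *)

(** No infinite sum is taken to the limit. A [k]-th matrix power enters the resolvent with a factor
    divisible by [t^k], so each coefficient of the series in play is a finite combination of traces;
    limits are taken coefficient by coefficient, after truncation to a sufficient order. Nor is
    [log det] formed, only its derivative, which is a trace; its part [N C' / C] is deterministic
    and ignored by covariances.

    The factor [p] in [p (X Y)^p] counts the rotations [k] in the formula of second order freeness:
    once all exponents are summed over, every rotation gives [(X Y)^p]. With the weights [1/p] from
    both logarithms, [sum_p p (X Y)^p / p^2] is [- log (1 - X Y)].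

    The series [H] vanishes for [t = s], hence has no logarithm among power series. Its mixed
    logarithmic derivative makes sense as a fraction, additive on products and blind to factors in
    one variable; it carries the last step. Substitution, however, acts on series and not on
    fractions, so denominators are cleared before [x = h(t)], [y = h(s)] is inserted. *)

Section PowerSeries.
Variable R : comNzRingType.
Implicit Types f g h : fps R.

Definition fpsC (c : R) : fps R := FPS (fun n => if n == 0 then c else 0).

Fact fpsC_is_zmod_morphism : zmod_morphism fpsC.
Proof. by move=> a b; apply: fpsP => -[|n] /=; rewrite ?subrr. Qed.

Fact fpsC_is_monoid_morphism : monoid_morphism fpsC.
Proof.
split=> [|a b]; first by apply: fpsP => -[|n].
apply: fpsP => -[|n]; first by rewrite fps_coefM big_ord1.
rewrite fps_coefM big_ord_recl /= mulr0 big1 ?addr0 // => i _.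
by rewrite mul0r.
Qed.

HB.instance Definition _ :=
  GRing.isZmodMorphism.Build R (fps R) fpsC fpsC_is_zmod_morphism.
HB.instance Definition _ :=
  GRing.isMonoidMorphism.Build R (fps R) fpsC fpsC_is_monoid_morphism.

Lemma fps_coefCM c f n : (fpsC c * f) n = c * f n.
Proof.
rewrite fps_coefM big_ord_recl /= subn0 big1 ?addr0 // => i _.
by rewrite mul0r.
Qed.

Lemma fps_coef_sum I (r : seq I) (Q : pred I) (F : I -> fps R) n :
  (\sum_(i <- r | Q i) F i) n = \sum_(i <- r | Q i) F i n.
Proof. by elim/big_rec2: _ => // i x y _ <-. Qed.

Lemma fps_coefMn f m n : (f *+ m) n = f n *+ m.
Proof. by elim: m => // m IH; rewrite !mulrS fps_coefD IH. Qed.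

Lemma fps_coef0M f g : (f * g) 0 = f 0 * g 0.
Proof. by rewrite fps_coefM big_ord1. Qed.

(** Congruence modulo [x^n]. A coefficient of an infinite sum is computed by replacing the sum with
    a finite one that is congruent to it to high enough order. *)
Definition eqfps n f g := forall i, (i < n)%N -> f i = g i.

Lemma eqfps_refl n f : eqfps n f f. Proof. by []. Qed.

Lemma eqfps_trans n f g h : eqfps n f g -> eqfps n g h -> eqfps n f h.
Proof. by move=> e1 e2 i lin; rewrite e1 ?e2. Qed.

Lemma eqfpsM n f f' g g' :
  eqfps n f f' -> eqfps n g g' -> eqfps n (f * g) (f' * g').
Proof.
move=> ef eg i lin; rewrite !fps_coefM; apply: eq_bigr => j _.
rewrite ef ?eg //; first exact: leq_ltn_trans (leq_subr _ _) lin.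
by apply: leq_ltn_trans lin; rewrite -ltnS.
Qed.

Lemma eqfps_sum n I (r : seq I) (Q : pred I) (F G : I -> fps R) :
  (forall i, Q i -> eqfps n (F i) (G i)) ->
  eqfps n (\sum_(i <- r | Q i) F i) (\sum_(i <- r | Q i) G i).
Proof.
by move=> e j ljn; rewrite !fps_coef_sum; apply: eq_bigr => i /e; apply.
Qed.

Lemma fps_mul_small m n f g :
  eqfps m f 0 -> eqfps n g 0 -> eqfps (m + n) (f * g) 0.
Proof.
move=> f0 g0 k lk; rewrite fps_coefM big1 // => i _.
have [lim|lmi] := ltnP i m; first by rewrite f0 // mul0r.
rewrite (g0 (k - i)%N) ?mulr0 // ltn_subLR; last by rewrite -ltnS.
by rewrite (leq_trans lk) // leq_add2r.
Qed.

Lemma fps_exp_small f n : f 0 = 0 -> eqfps n (f ^+ n) 0.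
Proof.
move=> f0; elim: n => // n IH; rewrite exprS -add1n.
by apply: fps_mul_small => // -[].
Qed.

Lemma fps_coefXM f n : (fpsX * f) n.+1 = f n.
Proof. by rewrite fps_mulXE. Qed.

Lemma fps_coefXM0 f : (fpsX * f) 0 = 0.
Proof. by rewrite fps_mulXE. Qed.

Lemma fps_mulX_inj f g : fpsX * f = fpsX * g -> f = g.
Proof. by move=> e; apply: fpsP => n; rewrite -fps_coefXM e fps_coefXM. Qed.

Lemma fps_coefXn n i : (fpsX ^+ n : fps R) i = (i == n)%:R.
Proof.
elim: n i => [|n IH] i //; rewrite exprS fps_mulXE.
by case: i => [|i] //; rewrite IH.
Qed.

Lemma fps_coef_deriv f n : fps_deriv f n = f n.+1 *+ n.+1.
Proof. by []. Qed.

Fact fps_deriv_is_zmod_morphism : zmod_morphism (@fps_deriv R).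
Proof. by move=> f g; apply: fpsP => n /=; rewrite mulrnBl. Qed.

HB.instance Definition _ := GRing.isZmodMorphism.Build (fps R) (fps R)
  (@fps_deriv R) fps_deriv_is_zmod_morphism.

Lemma fps_derivM f g :
  fps_deriv (f * g) = fps_deriv f * g + f * fps_deriv g.
Proof.
apply: fpsP => n; rewrite fps_coefD fps_coef_deriv !fps_coefM -sumrMnl.
rewrite (eq_bigr (fun i : 'I_n.+2 => f i *+ i * g (n.+1 - i)%N
    + f i * (g (n.+1 - i)%N *+ (n.+1 - i)))); last first.
  move=> i _; rewrite mulrnAl mulrnAr -mulrnDr subnKC //.
  by rewrite -ltnS.
rewrite big_split /=; congr (_ + _).
  rewrite big_ord_recl mulr0n mul0r add0r; apply: eq_bigr => i _.
  by rewrite /= /bump leq0n add1n subSS.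
rewrite big_ord_recr /= subnn mulr0n mulr0 addr0; apply: eq_bigr => i _.
by rewrite subSn // -ltnS.
Qed.

Lemma fps_derivX : fps_deriv (fpsX : fps R) = 1.
Proof. by apply: fpsP => -[|n] //=; rewrite mul0rn. Qed.

Lemma fps_derivC c : fps_deriv (fpsC c) = 0.
Proof. by apply: fpsP => n; rewrite /= mul0rn. Qed.

Lemma fps_deriv1 : fps_deriv (1 : fps R) = 0.
Proof. by rewrite -(rmorph1 fpsC) fps_derivC. Qed.

Lemma fps_deriv_exp f n :
  fps_deriv (f ^+ n.+1) = fps_deriv f * f ^+ n *+ n.+1.
Proof.
elim: n => [|n IH]; first by rewrite expr1 expr0 mulr1.
rewrite exprS fps_derivM IH [in RHS]mulrS mulrnAr; congr (_ + _ *+ _).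
by rewrite mulrCA -exprS.
Qed.

Lemma eqfps_deriv n f g : eqfps n.+1 f g -> eqfps n (fps_deriv f) (fps_deriv g).
Proof. by move=> e i lin; rewrite /= e. Qed.

Section Substitution.
Variable h : fps R.
Hypothesis h0 : h 0 = 0.

(** The hypothesis [h 0 = 0] is an argument because the ring morphism structure attached below to
    this wrapper of [fps_comp] depends on it. *)
Definition fps_subst of h 0 = 0 := fun f => fps_comp f h.
Arguments fps_subst : simpl never.

Lemma fps_substE f : fps_subst h0 f = fps_comp f h. Proof. by []. Qed.

(** [h ^+ n] starts at order [n], so terms with [n >= N] do not reach the coefficients below [N].
    The truncation order is free here, whereas [fps_comp] ties it to the coefficient. *)
Lemma eqfps_subst N f :
  eqfps N (fps_subst h0 f) (\sum_(n < N) fpsC (f n) * h ^+ n).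
Proof.
move=> k lkN; rewrite fps_coef_sum.
under [RHS]eq_bigr do rewrite fps_coefCM.
rewrite fps_substE /=.
rewrite [RHS](bigID (fun i : 'I_N => (i < k.+1)%N)) /=.
rewrite [X in _ = _ + X]big1 ?addr0 => [|i]; last first.
  by rewrite -leqNgt => lki; rewrite (fps_exp_small h0) ?mulr0.
by rewrite (big_ord_widen N (fun n => f n * (h ^+ n) k)).
Qed.

Lemma fps_substX : fps_subst h0 fpsX = h.
Proof.
apply: fpsP => k; rewrite (@eqfps_subst k.+2) // fps_coef_sum.
under eq_bigr do rewrite fps_coefCM.
rewrite 2!big_ord_recl /= mul0r add0r mul1r big1 ?addr0 // => i _.
by rewrite mul0r.
Qed.

Lemma fps_substC c : fps_subst h0 (fpsC c) = fpsC c.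
Proof.
apply: fpsP => k; rewrite (@eqfps_subst k.+1) // fps_coef_sum.
under eq_bigr do rewrite fps_coefCM.
rewrite big_ord_recl /= big1 ?addr0 => [|i _]; last by rewrite mul0r.
by case: (k == 0); rewrite ?mulr1 ?mulr0.
Qed.

Fact fps_subst_is_zmod_morphism : zmod_morphism (fps_subst h0).
Proof.
move=> f g; apply: fpsP => k; rewrite fps_coefB !fps_substE /= -sumrB.
apply: eq_bigr => i _.
by rewrite mulrBl.
Qed.

Fact fps_subst_is_monoid_morphism : monoid_morphism (fps_subst h0).
Proof.
split=> [|f g]; first by rewrite -(rmorph1 fpsC) fps_substC.
apply: fpsP => k; have lk : (k < k.+1)%N by [].
rewrite (eqfpsM (@eqfps_subst k.+1 f) (@eqfps_subst k.+1 g) lk).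
rewrite (@eqfps_subst k.+1) //.
set N := k.+1; rewrite mulr_suml !fps_coef_sum.
pose F i j := f i * g j * (h ^+ (i + j)) k.
(* Pairs with [i + j >= N] carry [h ^+ (i + j)], whose coefficient at [k < N] is zero; the others
   are regrouped by [n = i + j]. *)
transitivity (\sum_(i < N) \sum_(j < N | (i + j < N)%N) F i j); last first.
  apply: eq_bigr => i _; rewrite mulr_sumr fps_coef_sum.
  rewrite [RHS](bigID (fun j : 'I_N => (i + j < N)%N)).
  rewrite [X in _ = _ + X]big1 ?addr0 => [|j].
    apply: eq_bigr => j _.
    by rewrite mulrACA -rmorphM fps_coefCM -exprD.
  rewrite -leqNgt => lN.
  rewrite mulrACA -rmorphM fps_coefCM -exprD (fps_exp_small h0) ?mulr0 //.
transitivity (\sum_(n < N) \sum_(i < N | (i <= n)%N) F i (n - i)%N).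
  apply: eq_bigr => n _; rewrite fps_coefCM fps_coefM mulr_suml.
  rewrite (big_ord_widen N
    (fun i => f i * g (n - i)%N * (h ^+ n) k)) //.
  by apply: eq_bigr => i lin; rewrite /F subnKC // -ltnS.
rewrite (exchange_big_dep xpredT) //=; apply: eq_bigr => i _.
rewrite -(big_mkord (fun n => i <= n)%N (fun n => F i (n - i)%N)).
rewrite -(big_mkord (fun j => i + j < N)%N (fun j => F i j)).
rewrite (big_cat_nat _ (n := i)) //=; last exact: ltnW.
rewrite big_nat_cond big1 ?add0r => [|n]; last first.
  by rewrite leq0n /= ltnNge; case: leqP.
rewrite [RHS](big_cat_nat _ (n := (N - i)%N)) ?leq_subr //=.
rewrite [X in _ + X]big_nat_cond [X in _ + X]big1 ?addr0; last first.
  by move=> n /andP[/andP[]]; rewrite leq_subLR => le _; rewrite ltnNge le.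
rewrite -{1}[nat_of_ord i]add0n big_addn !big_mkord.
by apply: eq_big => [j|j _]; rewrite ?addnK // leq_addl -ltn_subRL ltn_ord.
Qed.

HB.instance Definition _ := GRing.isZmodMorphism.Build (fps R) (fps R)
  (fps_subst h0) fps_subst_is_zmod_morphism.
HB.instance Definition _ := GRing.isMonoidMorphism.Build (fps R) (fps R)
  (fps_subst h0) fps_subst_is_monoid_morphism.

Lemma fps_subst_coef0 f : (fps_subst h0 f) 0 = f 0.
Proof. by rewrite fps_substE /= big_ord1 expr0 mulr1. Qed.

Lemma fps_deriv_subst f :
  fps_deriv (fps_subst h0 f) = fps_subst h0 (fps_deriv f) * fps_deriv h.
Proof.
apply: fpsP => k; have lk : (k < k.+1)%N by [].
(* One order more than for the other factor: differentiation lowers the precision by one. *)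
rewrite (eqfps_deriv (@eqfps_subst k.+2 f) lk).
rewrite (eqfpsM (@eqfps_subst k.+1 _) (@eqfps_refl k.+1 _) lk).
congr (fps_coef _ _); rewrite raddf_sum mulr_suml big_ord_recl /=.
rewrite expr0 mulr1 fps_derivC add0r; apply: eq_bigr => n _.
rewrite fps_derivM fps_derivC mul0r add0r /bump add1n fps_deriv_exp.
rewrite raddfMn mulrnAr 2!mulrnAl -mulrA.
by rewrite [h ^+ n * _]mulrC.
Qed.

End Substitution.

Lemma fps_subst_idX (X0 : (fpsX : fps R) 0 = 0) f : fps_subst X0 f = f.
Proof.
apply: fpsP => k; rewrite (@eqfps_subst _ _ k.+1) // fps_coef_sum.
under eq_bigr do rewrite fps_coefCM fps_coefXn.
rewrite (bigD1 ord_max) //= eqxx mulr1 big1 ?addr0 // => i /negP ni.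
by case: eqP => [ki|]; rewrite ?mulr0 //; case: ni; apply/eqP/val_inj.
Qed.

Lemma fps_subst_comp h g (h0 : h 0 = 0) (g0 : g 0 = 0)
    (hg0 : (fps_subst h0 g) 0 = 0) f :
  fps_subst h0 (fps_subst g0 f) = fps_subst hg0 f.
Proof.
apply: fpsP => k; have lk : (k < k.+1)%N by [].
have aux F G : eqfps k.+1 F G ->
    eqfps k.+1 (fps_subst h0 F) (fps_subst h0 G).
  move=> e i li; rewrite !fps_substE /=; apply: eq_bigr => j _.
  by rewrite e // (leq_ltn_trans _ li) // -ltnS.
rewrite (aux _ _ (@eqfps_subst g g0 k.+1 f)) // (@eqfps_subst _ hg0 k.+1) //.
congr (fps_coef _ _); rewrite rmorph_sum; apply: eq_bigr => i _.
by rewrite rmorphM rmorphXn /= fps_substC.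
Qed.

(** The geometric series inverts [1 - w] when [w] has no constant term. *)
Lemma fps_geom f : f 0 = 1 -> exists g, g 0 = 1 /\ g * f = 1.
Proof.
move=> f1; have w0 : (1 - f) 0 = 0 by rewrite fps_coefB f1 subrr.
have e : (1 - fpsX) * FPS (fun=> 1) = 1 :> fps R.
  apply: fpsP => -[|n]; first by rewrite fps_coef0M /= subr0 mulr1.
  by rewrite mulrBl mul1r fps_coefB fps_coefXM /= subrr.
exists (fps_subst w0 (FPS (fun=> 1))); split; first by rewrite fps_subst_coef0.
rewrite mulrC -[X in X * _](subKr 1).
have -> : 1 - (1 - f) = fps_subst w0 (1 - fpsX).
  by rewrite rmorphB rmorph1 /= fps_substX.
by rewrite -rmorphM e rmorph1.
Qed.

End PowerSeries.

Arguments fpsC {R}.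
Arguments fps_subst {R h} h0 f : simpl never.

(** * Bivariate series *)

Section FpsMap.
Variables (R S : comNzRingType).

Definition fps_map (phi : R -> S) (f : fps R) : fps S :=
  FPS (fun n => phi (f n)).

Lemma fps_coef_map phi f n : fps_map phi f n = phi (f n). Proof. by []. Qed.

Section Morphism.
Variable phi : {rmorphism R -> S}.

Fact fps_map_is_zmod_morphism : zmod_morphism (fps_map phi).
Proof. by move=> f g; apply: fpsP => n /=; rewrite raddfB. Qed.

Fact fps_map_is_monoid_morphism : monoid_morphism (fps_map phi).
Proof.
split=> [|f g]; apply: fpsP => n.
  by rewrite fps_coef_map rmorph_nat.
rewrite fps_coefM fps_coef_map fps_coefM rmorph_sum; apply: eq_bigr => i _.
by rewrite rmorphM.
Qed.

HB.instance Definition _ := GRing.isZmodMorphism.Build (fps R) (fps S)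
  (fps_map phi) fps_map_is_zmod_morphism.
HB.instance Definition _ := GRing.isMonoidMorphism.Build (fps R) (fps S)
  (fps_map phi) fps_map_is_monoid_morphism.

Lemma fps_map_subst (h : fps R) (h0 : h 0 = 0) (ph0 : (fps_map phi h) 0 = 0) f :
  fps_map phi (fps_subst h0 f) = fps_subst ph0 (fps_map phi f).
Proof.
apply: fpsP => k; rewrite fps_substE [LHS]/= rmorph_sum.
by apply: eq_bigr => i _; rewrite rmorphM -rmorphXn.
Qed.

End Morphism.
End FpsMap.

Section Bivariate.
Variable R : comNzRingType.
Implicit Types (f g h : fps R) (F G : fps (fps R)).

(** The outer variable of an iterated series is [x]. Hence [fps_inx] embeds the coefficients as
    constants, [fps_iny] is an outer constant, and both inherit their morphism laws from [fpsC]. *)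
Lemma fps_inxE f : fps_inx f = fps_map fpsC f. Proof. by []. Qed.

Lemma fps_inyE f : fps_iny f = fpsC f.
Proof. by apply: fpsP => -[|m]; apply: fpsP. Qed.

Fact fps_inx_is_zmod_morphism : zmod_morphism (@fps_inx R).
Proof. by move=> f g; rewrite !fps_inxE rmorphB. Qed.
Fact fps_inx_is_monoid_morphism : monoid_morphism (@fps_inx R).
Proof. by split=> [|f g]; rewrite !fps_inxE (rmorph1, rmorphM). Qed.
HB.instance Definition _ := GRing.isZmodMorphism.Build (fps R) (fps (fps R))
  (@fps_inx R) fps_inx_is_zmod_morphism.
HB.instance Definition _ := GRing.isMonoidMorphism.Build (fps R) (fps (fps R))
  (@fps_inx R) fps_inx_is_monoid_morphism.

Fact fps_iny_is_zmod_morphism : zmod_morphism (@fps_iny R).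
Proof. by move=> f g; rewrite !fps_inyE rmorphB. Qed.
Fact fps_iny_is_monoid_morphism : monoid_morphism (@fps_iny R).
Proof. by split=> [|f g]; rewrite !fps_inyE (rmorph1, rmorphM). Qed.
HB.instance Definition _ := GRing.isZmodMorphism.Build (fps R) (fps (fps R))
  (@fps_iny R) fps_iny_is_zmod_morphism.
HB.instance Definition _ := GRing.isMonoidMorphism.Build (fps R) (fps (fps R))
  (@fps_iny R) fps_iny_is_monoid_morphism.

Lemma fps_coef_inxM f F i j :
  (fps_inx f * F) i j = \sum_(k < i.+1) f k * F (i - k)%N j.
Proof.
by rewrite fps_coefM fps_coef_sum; apply: eq_bigr => k _; rewrite fps_coefCM.
Qed.

Lemma fps_coef_inxy f g i j : (fps_inx f * fps_iny g) i j = f i * g j.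
Proof.
rewrite fps_coef_inxM big_ord_recr /= subnn big1 ?add0r // => k _.
by rewrite subn_eq0 leqNgt ltn_ord mulr0.
Qed.

Lemma fps_inx_inj : injective (@fps_inx R).
Proof.
by move=> f g e; apply: fpsP => n; rewrite -[f n]/(fps_inx f n 0) e.
Qed.

Lemma fps_iny_inj : injective (@fps_iny R).
Proof.
by move=> f g; rewrite !fps_inyE => /(congr1 (fun F => fps_coef F 0)).
Qed.

Lemma fps_inxX : fps_inx fpsX = fpsX :> fps (fps R).
Proof. by apply: fpsP => -[|[|m]]; apply: fpsP => -[|n]. Qed.

(** The derivation in the first variable is [fps_deriv]. *)
Definition fps_deriv_y : fps (fps R) -> fps (fps R) := fps_map (@fps_deriv R).

Fact fps_deriv_y_is_zmod_morphism : zmod_morphism fps_deriv_y.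
Proof. by move=> f g; apply: fpsP => n /=; rewrite raddfB. Qed.

HB.instance Definition _ :=
  GRing.isZmodMorphism.Build (fps (fps R)) (fps (fps R))
  fps_deriv_y fps_deriv_y_is_zmod_morphism.

Lemma fps_deriv_yM F G :
  fps_deriv_y (F * G) = fps_deriv_y F * G + F * fps_deriv_y G.
Proof.
apply: fpsP => n; rewrite fps_coefD !fps_coefM fps_coef_map fps_coefM raddf_sum.
by rewrite -big_split; apply: eq_bigr => i _; rewrite /= fps_derivM.
Qed.

Lemma fps_deriv_xyC F : fps_deriv (fps_deriv_y F) = fps_deriv_y (fps_deriv F).
Proof. by apply: fpsP => n; rewrite /= raddfMn. Qed.

Lemma fps_deriv_inx f : fps_deriv (fps_inx f) = fps_inx (fps_deriv f).
Proof.
apply: fpsP => n; rewrite fps_coef_deriv -[fps_inx _ n]/(fpsC _).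
by rewrite fps_coef_deriv raddfMn.
Qed.

Lemma fps_deriv_iny f : fps_deriv (fps_iny f) = 0.
Proof. by rewrite fps_inyE fps_derivC. Qed.

Lemma fps_deriv_y_inx f : fps_deriv_y (fps_inx f) = 0.
Proof. by apply: fpsP => n; apply: fps_derivC. Qed.

Lemma fps_deriv_y_iny f : fps_deriv_y (fps_iny f) = fps_iny (fps_deriv f).
Proof. by rewrite !fps_inyE; apply: fpsP => -[|n] //=; rewrite raddf0. Qed.

Lemma fps_inx_coef0 h : h 0 = 0 -> (fps_inx h) 0 = 0.
Proof. by move=> h0; rewrite -(rmorph0 fpsC) -h0. Qed.

Section Substitution2.
Variables (h : fps R) (h0 : h 0 = 0).

(** The substitution is made in the coefficients (variable [y]) and then in the outer variable, so
    that it is visibly a composite of ring morphisms. *)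
Definition fps_subst2 F :=
  fps_subst (fps_inx_coef0 h0) (fps_map (fps_subst h0) F).
Arguments fps_subst2 : simpl never.

Lemma fps_subst2E F : fps_subst2 F = fps_comp2 F h h.
Proof.
apply: fpsP => i; apply: fpsP => j; rewrite /fps_subst2 fps_substE [LHS]/=.
rewrite fps_coef_sum; apply: eq_bigr => m _.
rewrite -rmorphXn mulrC -[fps_inx _ _]/(fpsC _) fps_coefCM fps_substE.
by rewrite /= mulr_sumr; apply: eq_bigr => n _; rewrite mulrCA !mulrA.
Qed.

Fact fps_subst2_is_zmod_morphism : zmod_morphism fps_subst2.
Proof. by move=> F G; rewrite /fps_subst2 !rmorphB. Qed.
Fact fps_subst2_is_monoid_morphism : monoid_morphism fps_subst2.
Proof. by split=> [|F G]; rewrite /fps_subst2 ?rmorphM ?rmorph1. Qed.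
HB.instance Definition _ := GRing.isZmodMorphism.Build (fps (fps R))
  (fps (fps R)) fps_subst2 fps_subst2_is_zmod_morphism.
HB.instance Definition _ := GRing.isMonoidMorphism.Build (fps (fps R))
  (fps (fps R)) fps_subst2 fps_subst2_is_monoid_morphism.

Lemma fps_subst_inx (ih0 : fps_inx h 0 = 0) f :
  fps_subst ih0 (fps_inx f) = fps_inx (fps_subst h0 f).
Proof. exact/esym/(@fps_map_subst _ _ fpsC h h0 ih0 f). Qed.

Lemma fps_map_subst_inx f : fps_map (fps_subst h0) (fps_inx f) = fps_inx f.
Proof. by apply: fpsP => n; rewrite /= -[FPS _]/(fpsC _) fps_substC. Qed.

Lemma fps_subst2_inx f : fps_subst2 (fps_inx f) = fps_inx (fps_subst h0 f).
Proof. by rewrite /fps_subst2 fps_map_subst_inx fps_subst_inx. Qed.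

Lemma fps_subst2_iny f : fps_subst2 (fps_iny f) = fps_iny (fps_subst h0 f).
Proof.
rewrite /fps_subst2 !fps_inyE.
have -> : fps_map (fps_subst h0) (fpsC f) = fpsC (fps_subst h0 f).
  by apply: fpsP => -[|n] //=; rewrite rmorph0.
by rewrite fps_substC.
Qed.

End Substitution2.

Lemma fps_subst2_comp h g (h0 : h 0 = 0) (g0 : g 0 = 0) :
  fps_subst h0 g = fpsX -> forall F, fps_subst2 h0 (fps_subst2 g0 F) = F.
Proof.
move=> hgX F; rewrite /fps_subst2.
have ig0 : fps_map (fps_subst h0) (fps_inx g) 0 = 0.
  by rewrite fps_map_subst_inx fps_inx_coef0.
(* The proof [ig0] occurs in the goal, so it is generalized before its type is rewritten; the same
   device serves for [iX0] and [X0]. *)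
rewrite (@fps_map_subst _ _ (fps_subst h0) _ _ ig0); move: ig0.
rewrite fps_map_subst_inx => ig0.
have iX0 : fps_subst (fps_inx_coef0 h0) (fps_inx g) 0 = 0.
  by rewrite fps_subst_inx hgX fps_inx_coef0.
rewrite (@fps_subst_comp _ _ _ (fps_inx_coef0 h0) ig0 iX0).
move: iX0; rewrite (fps_subst_inx h0 (fps_inx_coef0 h0) g) hgX fps_inxX => iX0.
rewrite fps_subst_idX; apply: fpsP => n /=.
have X0 : fps_subst h0 g 0 = 0 by rewrite hgX.
rewrite (@fps_subst_comp _ _ _ h0 g0 X0); move: X0; rewrite hgX => X0.
by rewrite fps_subst_idX.
Qed.

End Bivariate.

Arguments fps_subst2 {R h} h0 F : simpl never.

(** * Moments and cumulants as inverse series *)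

Section Inversion.
Variable K : idomainType.
Implicit Types C M f : fps K.

Lemma fps_unit1 f : f 0 = 1 -> f \is a GRing.unit.
Proof.
by move=> /fps_geom[g [_ gf]]; apply/unitrP; exists g; rewrite gf mulrC gf.
Qed.

Lemma fps_inv_coef0 f : f 0 = 1 -> f^-1 0 = 1.
Proof.
move=> f1; have := congr1 (fun g : fps K => g 0) (mulVr (fps_unit1 f1)).
by rewrite fps_coef0M f1 mulr1.
Qed.

Lemma fps_divX_coef0 C : (fpsX / C) 0 = 0.
Proof. exact: fps_coefXM0. Qed.

Lemma fps_deriv_divX C : C 0 = 1 ->
  fps_deriv (fpsX / C) = C^-1 - fpsX / C * (fps_deriv C / C).
Proof.
move=> C0; have CU := fps_unit1 C0; apply: (mulIr CU).
have := fps_derivM (fpsX / C) C; rewrite mulrVK // fps_derivX.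
move=> e; rewrite mulrBl mulVr // -(mulrA (fpsX / C)) mulrVK //.
by rewrite [in RHS]e addrK.
Qed.

(** The series [x M] starts with [x], so composition with it preserves the lowest non-zero
    coefficient. *)
Lemma fps_subst_inj M (g0 : (fpsX * M) 0 = 0) :
  M 0 = 1 -> injective (fps_subst g0).
Proof.
move=> M0 f1 f2 /eqP; rewrite -subr_eq0 -rmorphB => /eqP e.
apply/eqP; rewrite -subr_eq0; apply/eqP; move: (f1 - f2) e => f e.
apply/eqP; apply: contraT => /fps_neq0_min[n /eqP fnz fn].
case: fnz; have := congr1 (fun f : fps K => f n) e.
have lnS : (n < n.+1)%N by [].
rewrite (@eqfps_subst _ _ g0 n.+1) // fps_coef_sum big_ord_recr big1.
  rewrite [LHS]add0r fps_coefCM exprMn fps_coef0 -[nat_of_ord _]/n.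
  suff -> : (fpsX ^+ n * M ^+ n) n = 1 by rewrite mulr1.
  elim: n {fn lnS} => [|n IH]; first by rewrite !expr0 mulr1.
  rewrite exprS -mulrA fps_coefXM exprS mulrCA.
  have M1 : eqfps 1 (M - 1) 0 by case=> // _; rewrite fps_coefB M0 subrr.
  have XMn : eqfps (n + 0) (fpsX ^+ n * M ^+ n) 0.
    by apply: fps_mul_small => //; apply: fps_exp_small.
  rewrite -{1}(subrK 1 M) mulrDl mul1r fps_coefD IH.
  rewrite (fps_mul_small M1 XMn) ?fps_coef0 ?add0r // addn0 ltnSn //.
by move=> i _; rewrite fps_coefCM (fn i) // mul0r.
Qed.

Variables C M : fps K.
Hypotheses (C0 : C 0 = 1) (M0 : M 0 = 1) (CM : fps_comp C (fpsX * M) = M).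
Let h0 := fps_divX_coef0 C.

(** With [g = x M], the relation [C(g) = M] says that [g / C(g) = x]. *)
Lemma fps_subst_divXK : fps_subst (fps_coefXM0 M) (fpsX / C) = fpsX.
Proof.
apply: (mulIr (fps_unit1 M0)); rewrite -[X in _ * X]CM.
rewrite -[fps_comp _ _]/(fps_subst (fps_coefXM0 M) C) -rmorphM.
by rewrite mulrVK ?fps_unit1 //= fps_substX.
Qed.

(** A one-sided inverse becomes two-sided: composition with [g = x M] is injective, so it suffices
    to compose once more with [g] and use [h(g) = x]. *)
Lemma fps_subst_divX : fps_subst h0 (fpsX * M) = fpsX.
Proof.
apply: (@fps_subst_inj M (fps_coefXM0 M)) => //.
have gh0 : fps_subst (fps_coefXM0 M) (fpsX / C) 0 = 0.
  by rewrite fps_subst_coef0.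
rewrite (@fps_subst_comp _ _ _ (fps_coefXM0 M) h0 gh0).
move: gh0; rewrite fps_subst_divXK => X0.
by rewrite fps_subst_idX fps_substX.
Qed.

(** From [h M(h) = x] and [h = x / C]. In this form, [M(x / C) = C], the first order cumulants enter
    the rest of the proof. *)
Lemma fps_subst_divX_moment : fps_subst h0 M = C.
Proof.
apply: (@fps_mulX_inj K); rewrite -[in RHS]fps_subst_divX rmorphM /=.
rewrite fps_substX mulrAC mulrVK ?fps_unit1 //.
Qed.

End Inversion.

(** Both [x / C] and [x / C'] are compositional inverses of [x M(x)]. *)
Lemma fps_subst_divX_uniq (K : idomainType) (C C' M : fps K) :
  C 0 = 1 -> C' 0 = 1 -> M 0 = 1 -> fps_comp C (fpsX * M) = M ->
  fps_subst (fps_divX_coef0 C') M = C' -> C = C'.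
Proof.
move=> C0 C'0 M0 CM hM.
have hg : fps_subst (fps_divX_coef0 C') (fpsX * M) = fpsX.
  by rewrite rmorphM /= fps_substX hM mulrVK // fps_unit1.
have hg0 : fps_subst (fps_divX_coef0 C') (fpsX * M) 0 = 0 by rewrite hg.
have := @fps_subst_comp _ _ _ (fps_divX_coef0 C') (fps_coefXM0 M) hg0
  (fpsX / C).
rewrite (fps_subst_divXK C0 M0 CM); move: hg0; rewrite hg => X0.
rewrite fps_subst_idX fps_substX => /fps_mulX_inj e.
by apply: invr_inj.
Qed.

Local Notation "f %:F" := (tofrac f).

(** * Mixed logarithmic derivatives *)

Lemma quotient_logD (F : fieldType) (e ex ey exy g gx gy gxy : F) :
  e != 0 -> g != 0 ->
  (e * g * (exy * g + ey * gx + (ex * gy + e * gxy))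
     - (ex * g + e * gx) * (ey * g + e * gy)) / (e * g) ^+ 2 =
  (e * exy - ex * ey) / e ^+ 2 + (g * gxy - gx * gy) / g ^+ 2.
Proof. by move=> e0 g0; field; rewrite e0 g0. Qed.

Section LogDerivative.
Variable K : fieldType.
Implicit Types E G : fps (fps K).

(** The mixed derivative [d^2/dxdy log E]. *)
Definition dlog2 E : {fraction fps (fps K)} :=
  (E * fps_deriv (fps_deriv_y E) - fps_deriv E * fps_deriv_y E)%:F / E%:F ^+ 2.

Lemma dlog2M E G : E != 0 -> G != 0 -> dlog2 (E * G) = dlog2 E + dlog2 G.
Proof.
rewrite -tofrac_eq0 => E0; rewrite -tofrac_eq0 => G0.
rewrite /dlog2 fps_deriv_yM [fps_deriv (_ + _)]raddfD /= !fps_derivM.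
rewrite !(tofracB, tofracM, tofracD).
exact: quotient_logD.
Qed.

(** Functions of one variable are invisible to the mixed derivative; this is what allows [H] to
    carry the factor [C(t) C(s)]. *)
Lemma dlog2_inx (f : fps K) : dlog2 (fps_inx f) = 0.
Proof.
by rewrite /dlog2 fps_deriv_y_inx raddf0 !mulr0 subr0 tofrac0 mul0r.
Qed.

Lemma dlog2_iny (f : fps K) : dlog2 (fps_iny f) = 0.
Proof.
rewrite /dlog2 fps_deriv_y_iny fps_deriv_iny fps_deriv_iny.
by rewrite mulr0 mul0r subr0 tofrac0 mul0r.
Qed.

(** For [f = h] and for [f = x], these are the two fractions of the second order cumulant relation
    after substitution. *)
Lemma dlog2_subxy (f : fps K) :
  dlog2 (fps_inx f - fps_iny f) =
  (fps_inx (fps_deriv f))%:F * (fps_iny (fps_deriv f))%:F /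
    ((fps_inx f)%:F - (fps_iny f)%:F) ^+ 2.
Proof.
rewrite /dlog2 [fps_deriv_y _]raddfB /= fps_deriv_y_inx fps_deriv_y_iny.
rewrite [fps_deriv _]raddfB /= raddf0 fps_deriv_iny.
rewrite [fps_deriv _]raddfB /= fps_deriv_inx fps_deriv_iny.
rewrite subrr mulr0 !sub0r subr0 mulrN opprK.
by rewrite tofracM tofracB.
Qed.

End LogDerivative.

Lemma fps_subxy_neq0 (K : fieldType) (f : fps K) :
  (exists2 n, (0 < n)%N & f n != 0) -> fps_inx f - fps_iny f != 0.
Proof.
move=> [[//|n] _ fn]; apply/eqP => /(congr1 (fun F : fps (fps K) => F n.+1 0)).
by rewrite !fps_coefB /= subr0 => /eqP; rewrite (negbTE fn).
Qed.

(** * The second order relation solved for the cumulants *)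

Section FieldIdentities.
Variable F : fieldType.
Implicit Types x y s c mx my gx gy dx dy hx hy cx cy px py a r : F.

Lemma clear_cumulant_denominators x y s c mx my gx gy dx dy :
  mx != 0 -> my != 0 -> gx - gy != 0 -> x - y != 0 ->
  s = c * (dx / mx) * (dy / my)
      + x * y * (dx * dy / (gx - gy) ^+ 2 - 1 / (x - y) ^+ 2) ->
  s * mx * my * (gx - gy) ^+ 2 * (x - y) ^+ 2 =
  c * dx * dy * (gx - gy) ^+ 2 * (x - y) ^+ 2
  + x * y * mx * my * (dx * dy * (x - y) ^+ 2 - (gx - gy) ^+ 2).
Proof. by move=> mx0 my0 g0 x0 ->; field; rewrite mx0 my0 g0 x0. Qed.

(** The letters after substitution: [x], [y] are the new variables [t], [s]; [hx = h(t)],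
    [cx = C(t)], [dx = h'(t)], and [px = g'(h(t))] with [g = x M]; [a] is [Rtransform2 a2] at
    [(h(t), h(s))], and [r] is [Rtransform2 kappa2]. *)
Lemma solve_cumulant x y hx hy cx cy px py dx dy a r :
  x != 0 -> y != 0 -> hx - hy != 0 -> x - y != 0 ->
  px * dx = 1 -> py * dy = 1 -> hx * cx = x -> hy * cy = y ->
  hx * (hy * a) * cx * cy * (x - y) ^+ 2 * (hx - hy) ^+ 2 =
    x * (y * r) * px * py * (x - y) ^+ 2 * (hx - hy) ^+ 2
    + hx * hy * cx * cy * (px * py * (hx - hy) ^+ 2 - (x - y) ^+ 2) ->
  r = dx * dy * a + dx * dy / (hx - hy) ^+ 2 - 1 * 1 / (x - y) ^+ 2.
Proof.
move=> x0 y0 h0 xy0 pdx pdy hcx hcy key.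
have xyh0 : x * y * (x - y) ^+ 2 * (hx - hy) ^+ 2 != 0.
  by rewrite !mulf_neq0 ?expf_neq0.
apply: (mulfI xyh0).
transitivity (x * (y * r) * px * py * (x - y) ^+ 2 * (hx - hy) ^+ 2
              * (dx * dy)).
  rewrite [RHS](_ : _ = x * y * (x - y) ^+ 2 * (hx - hy) ^+ 2 * r
                     * ((px * dx) * (py * dy))); last by ring.
  by rewrite pdx pdy !mulr1.
move/esym/(canRL (addrK _)): key => ->.
rewrite (_ : hx * (hy * a) * cx * cy * (x - y) ^+ 2 * (hx - hy) ^+ 2 =
  (hx * cx) * (hy * cy) * a * (x - y) ^+ 2 * (hx - hy) ^+ 2); last by ring.
rewrite (_ : hx * hy * cx * cy = (hx * cx) * (hy * cy)); last by ring.
rewrite hcx hcy.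
rewrite [LHS](_ : _ = x * y * ((dx * dy * a) * (x - y) ^+ 2 * (hx - hy) ^+ 2
  - (px * dx) * (py * dy) * (hx - hy) ^+ 2 + dx * dy * (x - y) ^+ 2));
  last by ring.
by rewrite pdx pdy; field; rewrite h0 xy0.
Qed.

End FieldIdentities.

Section SecondOrder.
Variables (K : fieldType) (a kappa : nat -> K) (a2 kappa2 : nat -> nat -> K).
Hypotheses (hk1 : free_cumulants1 a kappa) (hk2 : free_cumulants2 a a2 kappa2).

Let C := series1 kappa.
Let M := series1 a.
Let h0 := fps_divX_coef0 C.
Let h := fpsX / C.

(** The defining relation after the substitution [x := t / C(t)],
    [y := s / C(s)], which inverts [t = x M(x)]. *)
Lemma free_cumulants2_subst :
  (Rtransform2 kappa2)%:F =
    (fps_inx (fps_deriv h) * fps_iny (fps_deriv h) *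
       fps_subst2 h0 (Rtransform2 a2))%:F
    + dlog2 (fps_inx h - fps_iny h) - dlog2 (fps_inx fpsX - fps_iny fpsX).
Proof.
have C0 : C 0 = 1 by []. have M0 : M 0 = 1 by [].
have gX : fps_subst h0 (fpsX * M) = fpsX by exact: fps_subst_divX.
have hM : fps_subst h0 M = C by exact: fps_subst_divX_moment.
have hC : h * C = fpsX by rewrite mulrVK // fps_unit1.
have h1 : h 1 = 1 by rewrite fps_coefXM fps_inv_coef0.
(* An opaque [g]: otherwise [rmorphM] would split [fps_inx (fpsX * M)]. *)
have [g gE] : exists g, g = fpsX * M by exists (fpsX * M).
rewrite -gE in gX.
(* Chain rule in [g(h(t)) = t]. *)
have dg : fps_subst h0 (fps_deriv g) * fps_deriv h = 1.
  by rewrite -fps_deriv_subst gX fps_derivX.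
have X0 : fps_inx fpsX - fps_iny fpsX != 0 :> fps (fps K).
  by apply: fps_subxy_neq0; exists 1; rewrite //= oner_neq0.
have g0 : fps_inx g - fps_iny g != 0 :> fps (fps K).
  by apply: fps_subxy_neq0; exists 1; rewrite // gE fps_coefXM M0 oner_neq0.
have hx0 : fps_inx h - fps_iny h != 0 :> fps (fps K).
  by apply: fps_subxy_neq0; exists 1; rewrite // h1 oner_neq0.
have Mu : M != 0.
  by apply/eqP => /(congr1 (fun f : fps K => f 0)) /eqP; rewrite M0 oner_eq0.
have inx0 f : f != 0 -> fps_inx f != 0 :> fps (fps K).
  by move=> f0; rewrite -(rmorph0 (@fps_inx K)) (inj_eq (@fps_inx_inj K)).
have iny0 f : f != 0 -> fps_iny f != 0 :> fps (fps K).
  by move=> f0; rewrite -(rmorph0 (@fps_iny K)) (inj_eq (@fps_iny_inj K)).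
have XU : fpsX != 0 :> fps K.
  by apply/eqP => /(congr1 (fun f : fps K => f 1)) /eqP; rewrite oner_eq0.
have Mx0 : fps_inx M != 0 by apply: inx0.
have My0 : fps_iny M != 0 by apply: iny0.
have : series2 a2 * fps_inx M * fps_iny M * (fps_inx g - fps_iny g) ^+ 2
       * (fps_inx fpsX - fps_iny fpsX) ^+ 2
   = fps_comp2 (series2 kappa2) g g * fps_inx (fps_deriv g)
       * fps_iny (fps_deriv g) * (fps_inx g - fps_iny g) ^+ 2
       * (fps_inx fpsX - fps_iny fpsX) ^+ 2
     + fps_inx fpsX * fps_iny fpsX * fps_inx M * fps_iny M *
       (fps_inx (fps_deriv g) * fps_iny (fps_deriv g)
          * (fps_inx fpsX - fps_iny fpsX) ^+ 2
        - (fps_inx g - fps_iny g) ^+ 2).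
  apply/eqP; rewrite -tofrac_eq; apply/eqP.
  have:= hk2; rewrite /free_cumulants2 -/M -gE.
  rewrite -tofrac_eq0 in X0; rewrite -tofrac_eq0 in g0.
  rewrite -tofrac_eq0 in Mx0; rewrite -tofrac_eq0 in My0.
  rewrite !(tofracXn, tofracB, tofracD, tofracM) in X0 g0 *.
  exact: clear_cumulant_denominators.
move=> /(congr1 (fps_subst2 h0)) key.
have g0' : g 0 = 0 by rewrite gE fps_coefXM0.
rewrite !series2_Rtransform -(fps_subst2E g0') in key.
rewrite !(rmorphXn, rmorphB, rmorphD, rmorphM) /= !(fps_subst2_comp _ gX) in key.
rewrite !(fps_subst2_inx, fps_subst2_iny) gX hM !fps_substX -/h in key.
have dgx : fps_inx (fps_subst h0 (fps_deriv g)) * fps_inx (fps_deriv h) = 1.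
  by rewrite -rmorphM dg rmorph1.
have dgy : fps_iny (fps_subst h0 (fps_deriv g)) * fps_iny (fps_deriv h) = 1.
  by rewrite -rmorphM dg rmorph1.
have hCx : fps_inx h * fps_inx C = fps_inx fpsX by rewrite -rmorphM hC.
have hCy : fps_iny h * fps_iny C = fps_iny fpsX by rewrite -rmorphM hC.
move: (congr1 (@tofrac _) key) (congr1 (@tofrac _) dgx)
  (congr1 (@tofrac _) dgy) (congr1 (@tofrac _) hCx) (congr1 (@tofrac _) hCy).
move=> {}key {}dgx {}dgy {}hCx {}hCy.
rewrite !dlog2_subxy fps_derivX !rmorph1.
rewrite -tofrac_eq0 in X0; rewrite -tofrac_eq0 in hx0.
rewrite !(tofracXn, tofracB, tofracD, tofracM, tofrac1)
  in X0 hx0 key dgx dgy hCx hCy *.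
apply: (solve_cumulant _ _ hx0 X0 dgx dgy hCx hCy key).
  by rewrite tofrac_eq0 inx0.
by rewrite tofrac_eq0 iny0.
Qed.
End SecondOrder.

(** * Logarithmic derivatives of matrices of series *)

Section Matrices.
Variables (K : numFieldType) (N : nat).
Implicit Types (C f : fps K) (a b : 'M[K]_N) (A B : 'M[fps K]_N).

Definition const_fps_mx a : 'M[fps K]_N := map_mx fpsC a.
Definition deriv_mx A : 'M[fps K]_N := map_mx (@fps_deriv K) A.

Lemma mxtraceMC (R : comPzRingType) (X Y : 'M[R]_N) :
  \tr (X * Y) = \tr (Y * X).
Proof. exact: mxtrace_mulC. Qed.

Lemma mulmx1_comm (R : comPzRingType) (X Y : 'M[R]_N) : X * Y = 1 -> Y * X = 1.
Proof. exact: mulmx1C. Qed.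

Lemma deriv_mxM A B : deriv_mx (A * B) = deriv_mx A * B + A * deriv_mx B.
Proof.
apply/matrixP => i j; rewrite !mxE raddf_sum -big_split /=.
by apply: eq_bigr => k _; rewrite fps_derivM !mxE.
Qed.

Lemma deriv_mxB A B : deriv_mx (A - B) = deriv_mx A - deriv_mx B.
Proof. exact: map_mxB. Qed.

Lemma deriv_mx1 : deriv_mx 1 = 0.
Proof.
apply/matrixP => i j; rewrite !mxE; case: (i == j); rewrite ?raddf0 //.
exact: fps_deriv1.
Qed.

Lemma mxtrace_deriv A : fps_deriv (\tr A) = \tr (deriv_mx A).
Proof. by rewrite raddf_sum; apply: eq_bigr => i _; rewrite mxE. Qed.

(** Under the trace, each of the [n.+1] terms of the product rule can be rotated until the
    differentiated factor comes first. The spare factor [A ^+ m] lets the induction close. *)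
Lemma mxtrace_deriv_exp A n m :
  \tr (deriv_mx (A ^+ n.+1) * A ^+ m) = \tr (deriv_mx A * A ^+ (n + m)) *+ n.+1.
Proof.
elim: n m => [|n IH] m; first by rewrite expr1 mulr1n.
rewrite exprS deriv_mxM mulrDl mxtraceD -!mulrA [\tr (A * _)]mxtraceMC.
by rewrite -mulrA -exprSr IH addnS -exprD [RHS]mulrS.
Qed.

Section LogDet.
Variables (PA PB U V S : 'M[fps K]_N).
Hypotheses (PAU : PA * U = 1) (PBV : PB * V = 1).
Hypothesis PCS : (PA + PB - 1) * S = 1.
Let PC := PA + PB - 1.
Let Q := (U - 1) * (V - 1).

Lemma one_sub_alternating : 1 - Q = U * PC * V.
Proof.
have -> : U * PC * V = V + U - U * V.
  rewrite /PC mulrBr mulrDr mulrBl mulrDl (mulmx1_comm PAU) mul1r mulr1.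
  by rewrite -[_ * PB * _]mulrA PBV mulr1.
apply/esym/eqP; rewrite eq_sym subr_eq /Q mulrBr mulr1 mulrBl mul1r.
by rewrite addrA subrKA [V + U]addrC addrK subKr.
Qed.

Lemma one_sub_alternatingK : (1 - Q) * (PB * S * PA) = 1.
Proof.
rewrite one_sub_alternating -!mulrA [V * (PB * _)]mulrA (mulmx1_comm PBV) mul1r.
by rewrite [PC * (S * _)]mulrA PCS mul1r (mulmx1_comm PAU).
Qed.

(** [tr (P' P^-1)] is the derivative of [log det P], hence turns the
    factorization [1 - Q = U PC V] into a sum. *)
Lemma log_deriv_alternating :
  \tr (deriv_mx PC * S) = \tr (deriv_mx PA * U) + \tr (deriv_mx PB * V)
    - \tr (deriv_mx Q * (PB * S * PA)).
Proof.
have UPA := mulmx1_comm PAU; have VPB := mulmx1_comm PBV.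
(* Differentiating [X * Y = 1] gives [X' Y + X Y' = 0], read under the trace. *)
have dinv X Y : X * Y = 1 -> \tr (deriv_mx Y * X) = - \tr (deriv_mx X * Y).
  move=> XY; have := congr1 deriv_mx XY.
  rewrite deriv_mxM deriv_mx1 => /(congr1 (@mxtrace _ _)).
  rewrite mxtraceD [\tr (X * _)]mxtraceMC raddf0 => /eqP.
  by rewrite addrC addr_eq0 => /eqP.
have -> : deriv_mx Q = - deriv_mx (U * PC * V).
  by rewrite -one_sub_alternating deriv_mxB deriv_mx1 sub0r opprK.
have SPC : S * PC = 1 := mulmx1_comm PCS.
have VPBK X : V * (PB * X) = X by rewrite mulrA VPB mul1r.
rewrite mulNr raddfN opprK /= !deriv_mxM !mulrDl !mxtraceD.
have e1 : \tr (deriv_mx U * PC * V * (PB * S * PA)) = - \tr (deriv_mx PA * U).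
  by rewrite -!mulrA VPBK [PC * (S * _)]mulrA PCS mul1r dinv.
have e2 : \tr (U * deriv_mx PC * V * (PB * S * PA)) = \tr (deriv_mx PC * S).
  by rewrite -!mulrA VPBK mxtraceMC -!mulrA PAU mulr1.
have e3 : \tr (U * PC * deriv_mx V * (PB * S * PA)) = - \tr (deriv_mx PB * V).
  rewrite -!mulrA mxtraceMC -!mulrA PAU mulr1 mxtraceMC -!mulrA SPC mulr1.
  exact: dinv.
rewrite [X in _ = _ + (X + _ + _)]e1 [X in _ = _ + (_ + X + _)]e2.
rewrite [X in _ = _ + (_ + _ + X)]e3.
move: (\tr _) (\tr _) (\tr _) => x y z; ring.
Qed.

End LogDet.

Lemma small_mx_exp A n :
  (forall i j, A i j 0 = 0) -> forall i j, eqfps n ((A ^+ n) i j) 0.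
Proof.
move=> A0; elim: n => // n IH i j; rewrite exprS mxE => k lk.
rewrite fps_coef_sum big1 // => l _.
have A1 : eqfps 1 (A i l) 0 by case=> // _; apply: A0.
by rewrite (fps_mul_small A1 (IH l j)).
Qed.

(** Expansion of [- (log det (1 - A))'] as [sum_p (tr A^p)' / p]. Since [A] has no constant term,
    [A ^+ m] is divisible by [x^m] and the remainder misses the coefficient [n < m]. The factor
    [n.+1] comes from the derivative. *)
Lemma trace_log_coef A B n m : (n < m)%N ->
  (1 - A) * B = 1 -> (forall i j, A i j 0 = 0) ->
  (\tr (deriv_mx A * B)) n =
  \sum_(p < m) n.+1%:R / p.+1%:R * (\tr (A ^+ p.+1)) n.+1.
Proof.
move=> nm AB A0.
(* A finite geometric sum with exact remainder. *)
have BE k : B = \sum_(p < k) A ^+ p + A ^+ k * B.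
  elim: k => [|k IH]; first by rewrite big_ord0 add0r mul1r.
  rewrite big_ord_recr /= -addrA {1}IH; congr (_ + _).
  rewrite -{2}[A ^+ k]mulr1 -AB exprSr -mulrA -mulrDr -mulrDl.
  by rewrite subrK mul1r.
rewrite {1}(BE m) mulrDr mxtraceD fps_coefD [X in _ + X](_ : _ = 0); last first.
  rewrite mulrA mxtraceMC mulrA mxtraceMC /mxtrace fps_coef_sum big1 // => i _.
  rewrite mxE fps_coef_sum big1 // => j _.
  rewrite (@fps_mul_small _ m 0) ?addn0 //; exact: small_mx_exp.
rewrite addr0 mulr_sumr raddf_sum fps_coef_sum; apply: eq_bigr => p _.
have := mxtrace_deriv_exp A p 0; rewrite mulr1 addn0 -mxtrace_deriv.
move/(congr1 (fun f : fps K => f n)); rewrite fps_coef_deriv.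
rewrite fps_coefMn -[LHS]mulr_natl -[RHS]mulr_natl => e.
by rewrite mulrAC e mulrAC divff ?mul1r // pnatr_eq0.
Qed.

End Matrices.

(** * Resolvents *)

Section EqMx.
Variables (R : comNzRingType) (n : nat).
Implicit Types A B : 'M[fps R]_n.

Definition eqfps_mx m A B := forall i j, eqfps m (A i j) (B i j).

Lemma eqfps_mxM m A A' B B' :
  eqfps_mx m A A' -> eqfps_mx m B B' -> eqfps_mx m (A * B) (A' * B').
Proof.
by move=> eA eB i j; rewrite !mxE; apply: eqfps_sum => k _; apply: eqfpsM.
Qed.

Lemma eqfps_mx_exp m A B p : eqfps_mx m A B -> eqfps_mx m (A ^+ p) (B ^+ p).
Proof.
move=> e; elim: p => [|p IH]; first by move=> i j; rewrite !expr0.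
by rewrite !exprS; apply: eqfps_mxM.
Qed.

Lemma eqfps_mx_trace m A B : eqfps_mx m A B -> eqfps m (\tr A) (\tr B).
Proof. by move=> e; apply: eqfps_sum => i _; apply: e. Qed.

End EqMx.

Section Resolvent.
Variables (K : numFieldType) (N : nat).
Implicit Types (C : fps K) (a b : 'M[K]_N).

Definition pencil C a : 'M[fps K]_N := C%:M - fpsX *: const_fps_mx a.

Definition power_series_mx (c : nat -> 'M[K]_N) : 'M[fps K]_N :=
  \matrix_(i, j) FPS (fun k => c k i j).

(** The Neumann series [C^-1 sum_k (t / C)^k a^k] rather than an abstract inverse: each coefficient
    is then visibly a finite combination of powers of [a]. *)
Definition resolvent C a : 'M[fps K]_N :=
  C^-1 *: map_mx (fps_subst (fps_divX_coef0 C)) (power_series_mx (GRing.exp a)).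

Lemma pencilD C C' a b :
  pencil C a + pencil C' b - 1 = pencil (C + C' - 1) (a + b).
Proof.
rewrite /pencil /const_fps_mx map_mxD /= scalerDr opprD.
have -> : (C + C' - 1)%:M = C%:M + C'%:M - 1 :> 'M[fps K]_N.
  by rewrite raddfB raddfD.
by rewrite addrACA [LHS]addrAC.
Qed.

Lemma power_series_mxP a :
  (1 - fpsX *: const_fps_mx a) * power_series_mx (GRing.exp a) = 1.
Proof.
rewrite mulrBl mul1r; apply/matrixP => i j; rewrite !mxE; apply: fpsP => n.
rewrite fps_coefB fps_coef_sum.
rewrite (eq_bigr (fun k => (fpsX * (fpsC (a i k) *
  FPS (fun m => (a ^+ m) k j))) n)); last by move=> k _; rewrite !mxE mulrA.
case: n => [|n].
  rewrite big1 ?subr0 => [|k _]; last by rewrite fps_coefXM0.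
  by rewrite /= expr0 mxE; case: (i == j).
rewrite (eq_bigr (fun k => a i k * (a ^+ n) k j)); last first.
  by move=> k _; rewrite fps_coefXM fps_coefCM.
by rewrite /= exprS mxE subrr; case: (i == j).
Qed.

Lemma fps_subst_const_mx C a :
  map_mx (fps_subst (fps_divX_coef0 C)) (const_fps_mx a) = const_fps_mx a.
Proof. by apply/matrixP => i j; rewrite !mxE fps_substC. Qed.

Lemma resolventP C a : C 0 = 1 -> pencil C a * resolvent C a = 1.
Proof.
move=> C0; have CU := fps_unit1 C0.
have pE : pencil C a = C *: (1%:M - (fpsX / C) *: const_fps_mx a).
  by rewrite scalerBr scalemx1 scalerA [C * _]mulrCA (mulrV CU) mulr1.
rewrite -[_ * _]/(_ *m _) pE /resolvent -scalemxAl -scalemxAr scalerA (mulrV CU).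
rewrite scale1r.
have key : (1%:M - fpsX *: const_fps_mx a) *m power_series_mx (GRing.exp a)
  = 1%:M by exact: power_series_mxP.
have := congr1 (map_mx (fps_subst (fps_divX_coef0 C))) key.
rewrite map_mxM map_mxB !map_mx1 map_mxZ /=.
by rewrite fps_substX fps_subst_const_mx.
Qed.

Lemma fps_subst_mxtrace C (c : nat -> 'M[K]_N) :
  \tr (map_mx (fps_subst (fps_divX_coef0 C)) (power_series_mx c)) =
  fps_subst (fps_divX_coef0 C) (FPS (fun k => \tr (c k))).
Proof.
rewrite /mxtrace; under eq_bigr do rewrite !mxE.
by rewrite -raddf_sum; congr fps_subst; apply: fpsP => n; rewrite fps_coef_sum.
Qed.

(** This is the derivative of [N log C - sum_(k >= 1) h^k tr (a^k) / k] with [h = t / C]. The first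
    term does not depend on [a]. *)
Lemma log_deriv_pencil C a : C 0 = 1 ->
  \tr (deriv_mx (pencil C a) * resolvent C a) =
  fps_deriv C / C *+ N - fps_deriv (fpsX / C) *
    fps_subst (fps_divX_coef0 C) (FPS (fun k => \tr (a ^+ k.+1))).
Proof.
move=> C0; have CU := fps_unit1 C0; set h := fpsX / C.
have -> : deriv_mx (pencil C a) = (fps_deriv C)%:M - const_fps_mx a.
  apply/matrixP => i j; rewrite !mxE raddfB raddfMn /= fps_derivM fps_derivX.
  by rewrite fps_derivC mulr0 addr0 mul1r.
rewrite -[_ * _]/(_ *m _) mulmxBl mul_scalar_mx raddfB /= mxtraceZ.
rewrite /resolvent -scalemxAr !mxtraceZ.
set T := power_series_mx _.
have aT : const_fps_mx a *m T = power_series_mx (fun k => a ^+ k.+1).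
  apply/matrixP => i j; rewrite !mxE; apply: fpsP => n.
  rewrite fps_coef_sum [RHS]/= exprS mxE; apply: eq_bigr => k _.
  by rewrite !mxE fps_coefCM.
rewrite -[X in \tr (X *m _)](fps_subst_const_mx C a) -map_mxM aT.
rewrite !fps_subst_mxtrace.
have -> : FPS (fun k => \tr (a ^+ k)) =
    N%:R + fpsX * FPS (fun k => \tr (a ^+ k.+1)).
  apply: fpsP => -[|n]; last first.
    by rewrite fps_coefD fps_coefXM -[N%:R]/(1 *+ N) fps_coefMn mul0rn add0r.
  by rewrite fps_coefD fps_coefXM0 fps_coefMn addr0 /= expr0 mxtrace1.
rewrite rmorphD rmorph_nat rmorphM /= fps_substX.
rewrite fps_deriv_divX // -/h.
set t := fps_subst _ _; rewrite -mulr_natr; ring.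
Qed.

End Resolvent.

(** * Resolvents as series in centered powers *)

Section Centered.
Variables (K : numFieldType) (N : nat).
Implicit Types (C : fps K) (al : nat -> K) (a b : 'M[K]_N).

Definition centered_mx al a k : 'M[K]_N := a ^+ k - (al k)%:M.

(** The coefficient of [a ^+ k] in [resolvent C a]; it is divisible by [x^k]. *)
Definition weight C k : fps K := C^-1 * (fpsX / C) ^+ k.

(** Since [M(t / C) = C], the identity is itself the series [C^-1 sum_k (t / C)^k al_k] with
    [al_0 = 1]; subtracting it centers every power at once and cancels the term of exponent zero. *)
Lemma resolvent_centered C al a : C 0 = 1 ->
  fps_subst (fps_divX_coef0 C) (series1 al) = C ->
  resolvent C a - 1 = C^-1 *: map_mx (fps_subst (fps_divX_coef0 C))
    (power_series_mx (fun k => if k == 0 then 0 else centered_mx al a k)).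
Proof.
move=> C0 CM; have CU := fps_unit1 C0.
have -> : power_series_mx (fun k => if k == 0 then 0 else centered_mx al a k)
    = power_series_mx (GRing.exp a) - (series1 al)%:M.
  apply/matrixP => i j; rewrite !mxE; apply: fpsP => -[|k].
    by rewrite fps_coefB fps_coefMn /= expr0 !mxE subrr.
  by rewrite fps_coefB fps_coefMn /= !mxE.
rewrite map_mxB map_scalar_mx /= CM scalerBr -[(C%:M)]scalemx1 scalerA.
by rewrite (mulVr CU) scale1r.
Qed.

(** Exponents run from [1] to [I], whence the shift [k.+1]; by divisibility of the weights the
    omitted terms start at order [I.+1]. *)
Lemma resolvent_trunc C al a I : C 0 = 1 ->
  fps_subst (fps_divX_coef0 C) (series1 al) = C ->
  eqfps_mx I.+1 (resolvent C a - 1)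
    (\sum_(k < I) weight C k.+1 *: const_fps_mx (centered_mx al a k.+1)).
Proof.
move=> C0 CM; rewrite (resolvent_centered _ C0 CM) => i j.
rewrite summxE !mxE.
apply: eqfps_trans (eqfpsM (@eqfps_refl _ _ _) (@eqfps_subst _ _ _ _ _)) _.
rewrite big_ord_recl /= mxE raddf0 mul0r add0r mulr_sumr.
apply: eqfps_sum => k _; rewrite !mxE /weight [fpsC _ * _]mulrC mulrA.
exact: eqfps_refl.
Qed.

Lemma resolvent_coef0 C al a : C 0 = 1 ->
  fps_subst (fps_divX_coef0 C) (series1 al) = C ->
  forall i j, (resolvent C a - 1) i j 0 = 0.
Proof.
move=> C0 CM i j; rewrite (@resolvent_trunc _ _ a 0 C0 CM) ?big_ord0 //.
by rewrite mxE.
Qed.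

Lemma const_fps_mxM a b :
  const_fps_mx (a * b) = const_fps_mx a * const_fps_mx b.
Proof. exact: map_mxM. Qed.

Lemma const_fps_mx_prod p (f : 'I_p -> 'M[K]_N) :
  const_fps_mx (\prod_x f x) = \prod_x const_fps_mx (f x).
Proof.
apply: (big_morph _ const_fps_mxM); exact: map_mx1.
Qed.

Lemma scaler_prod_mx p (c : 'I_p -> fps K) (f : 'I_p -> 'M[fps K]_N) :
  \prod_x (c x *: f x) = \prod_x c x *: \prod_x f x.
Proof.
elim: p c f => [|p IH] c f; first by rewrite !big_ord0 scale1r.
rewrite !big_ord_recl IH -!mulmxE.
by rewrite -scalemxAl -scalemxAr scalerA.
Qed.

Lemma trace_const_fps_mx a : \tr (const_fps_mx a) = fpsC (\tr a).
Proof. by rewrite raddf_sum; apply: eq_bigr => i _; rewrite mxE. Qed.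

(** The product of [p] double sums is expanded: [F] chooses a pair of exponents at each of the [p]
    positions. *)
Lemma trace_alternating_coef C C' al be a b p I i : C 0 = 1 -> C' 0 = 1 ->
  fps_subst (fps_divX_coef0 C) (series1 al) = C ->
  fps_subst (fps_divX_coef0 C') (series1 be) = C' -> (i <= I)%N ->
  (\tr (((resolvent C a - 1) * (resolvent C' b - 1)) ^+ p)) i =
  \sum_(F : {ffun 'I_p -> 'I_I * 'I_I})
    (\prod_x (weight C (F x).1.+1 * weight C' (F x).2.+1)) i *
    \tr (\prod_x (centered_mx al a (F x).1.+1 * centered_mx be b (F x).2.+1)).
Proof.
move=> C0 C'0 CM CM' iI.
have eQ := eqfps_mxM (@resolvent_trunc _ _ a I C0 CM)
  (@resolvent_trunc _ _ b I C'0 CM').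
rewrite (eqfps_mx_trace (eqfps_mx_exp p eQ)) // => {eQ}.
have -> : (\sum_(k < I) weight C k.+1 *: const_fps_mx (centered_mx al a k.+1))
  * (\sum_(k < I) weight C' k.+1 *: const_fps_mx (centered_mx be b k.+1))
  = \sum_(k : 'I_I * 'I_I) (weight C k.1.+1 * weight C' k.2.+1) *:
      const_fps_mx (centered_mx al a k.1.+1 * centered_mx be b k.2.+1).
  rewrite mulr_suml; under eq_bigr do rewrite mulr_sumr.
  rewrite pair_bigA /=; apply: eq_bigr => k _.
  by rewrite const_fps_mxM -!mulmxE -scalemxAl -scalemxAr scalerA.
rewrite -[X in _ ^+ X]card_ord -prodr_const bigA_distr_bigA /=.
rewrite raddf_sum fps_coef_sum; apply: eq_bigr => F _ /=.
rewrite scaler_prod_mx mxtraceZ -const_fps_mx_prod trace_const_fps_mx.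
by rewrite mulrC fps_coefCM mulrC.
Qed.

End Centered.

(** * Random variables with moments of all orders *)

Section Moments.
Context d (T : measurableType d) (R : realType) (P : probability T R).
Implicit Types (f g : T -> R) (X Y Z : T -> cplx R).

Definition real_moments f := forall k : nat, (1 <= k)%N -> f \in Lfun P k%:R%:E.

Lemma natr_ge1E k : (1 <= k)%N -> (1 <= (k%:R : R)%:E)%E.
Proof. by rewrite lee_fin ler1n. Qed.

Lemma real_moments_cst c : real_moments (fun=> c).
Proof. by move=> k _; exact: Lfun_cst. Qed.

Lemma real_momentsD f g : real_moments f -> real_moments g ->
  real_moments (fun w => f w + g w).
Proof.
by move=> mf mg k k1; apply: (Lfun_addr_closed P (natr_ge1E k1)).2;
  [exact: mf | exact: mg].
Qed.

Lemma real_momentsZ c f : real_moments f -> real_moments (fun w => f w * c).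
Proof.
by move=> mf k k1; apply: Lfun_scale; [rewrite ler1n | exact: mf].
Qed.

(** The [k]-th absolute moment of [f^2] is the [2k]-th of [f]. *)
Lemma real_moments_sqr f : real_moments f -> real_moments (fun w => f w ^+ 2).
Proof.
move=> mf k k1; have := mf (2 * k)%N; rewrite muln_gt0 k1 => /(_ isT) f2k.
have k2 : 1 <= (2 * k)%:R :> R by rewrite ler1n muln_gt0.
have [mfun _] := andP f2k; have /integrableP[_ iF] := Lfun_integrable k2 f2k.
rewrite inE; apply/andP; split; rewrite inE /=.
  by apply: measurable_funX; move: mfun; rewrite inE.
rewrite /finite_norm unlock poweR_lty //; apply: le_lt_trans iF.
rewrite le_eqVlt; apply/orP; left; apply/eqP; apply: eq_integral => w _.
rewrite /= !powR_mulrn //; congr _%:E.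
by rewrite !normrX normr_id exprM.
Qed.

(** Polarization, [4 f g = (f + g)^2 - (f - g)^2], reduces products to squares. *)
Lemma real_momentsM f g : real_moments f -> real_moments g ->
  real_moments (fun w => f w * g w).
Proof.
move=> mf mg; have := real_momentsZ (-1) mg => mNg.
have := real_momentsD (real_moments_sqr (real_momentsD mf mg))
  (real_momentsZ (-1) (real_moments_sqr (real_momentsD mf mNg))).
move=> /(real_momentsZ 4^-1); congr real_moments; apply: funext => w.
by field.
Qed.

Lemma has_all_momentsE X : has_all_moments P X <->
  real_moments (fun w => complex.Re (X w)) /\
  real_moments (fun w => complex.Im (X w)).
Proof.
split=> [mX|[mr mi] k k1]; last by split; [exact: mr | exact: mi].
by split=> k k1; case: (mX k k1).
Qed.

Lemma Re_cplxM (x y : cplx R) : complex.Re (x * y) =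
  complex.Re x * complex.Re y - complex.Im x * complex.Im y.
Proof. by case: x y => [a b] [c e]. Qed.

Lemma Im_cplxM (x y : cplx R) : complex.Im (x * y) =
  complex.Re x * complex.Im y + complex.Im x * complex.Re y.
Proof. by case: x y => [a b] [c e]. Qed.

Lemma Re_cplxD (x y : cplx R) :
  complex.Re (x + y) = complex.Re x + complex.Re y.
Proof. by case: x y => [a b] [c e]. Qed.

Lemma Im_cplxD (x y : cplx R) :
  complex.Im (x + y) = complex.Im x + complex.Im y.
Proof. by case: x y => [a b] [c e]. Qed.

Lemma eq_cplx (x y : cplx R) : complex.Re x = complex.Re y ->
  complex.Im x = complex.Im y -> x = y.
Proof. by case: x y => [a b] [c e] /= -> ->. Qed.

Lemma moments_cst c : has_all_moments P (fun=> c).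
Proof. by apply/has_all_momentsE; split; apply: real_moments_cst. Qed.

Lemma momentsD X Y : has_all_moments P X -> has_all_moments P Y ->
  has_all_moments P (fun w => X w + Y w).
Proof.
move=> /has_all_momentsE[Xr Xi] /has_all_momentsE[Yr Yi].
apply/has_all_momentsE; split.
  by under eq_fun do rewrite Re_cplxD; apply: real_momentsD.
by under eq_fun do rewrite Im_cplxD; apply: real_momentsD.
Qed.

Lemma momentsM X Y : has_all_moments P X -> has_all_moments P Y ->
  has_all_moments P (fun w => X w * Y w).
Proof.
move=> /has_all_momentsE[Xr Xi] /has_all_momentsE[Yr Yi].
apply/has_all_momentsE; split; last first.
  under eq_fun do rewrite Im_cplxM.
  by apply: real_momentsD; apply: real_momentsM.
under eq_fun do rewrite Re_cplxM -mulrN1; apply: real_momentsD.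
  exact: real_momentsM.
by apply: real_momentsZ; apply: real_momentsM.
Qed.

Lemma moments_sum I (r : seq I) (Q : pred I) (F : I -> T -> cplx R) :
  (forall i, Q i -> has_all_moments P (F i)) ->
  has_all_moments P (fun w => \sum_(i <- r | Q i) F i w).
Proof.
move=> mF; elim: r => [|i r IH].
  by under eq_fun do rewrite big_nil; apply: moments_cst.
have [Qi|/negbTE Qi] := boolP (Q i); last by under eq_fun do rewrite big_cons Qi.
by under eq_fun do rewrite big_cons Qi; apply: momentsD => //; apply: mF.
Qed.

Lemma real_moments_Lfun1 f : real_moments f -> f \in Lfun P 1.
Proof. by move=> mf; apply: (mf 1). Qed.

Lemma real_EZ f c : real_moments f ->
  fine 'E_P[fun w => f w * c] = fine 'E_P[f] * c.
Proof.
move=> mf; have mf1 := real_moments_Lfun1 mf.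
have -> : ('E_P[(fun w => f w * c)%R] = c%:E * 'E_P[f])%E := expectationZl c mf1.
by rewrite fineM ?expectation_fin_num // mulrC.
Qed.

Lemma real_ED f g : real_moments f -> real_moments g ->
  fine 'E_P[fun w => f w + g w] = fine 'E_P[f] + fine 'E_P[g].
Proof.
move=> mf mg.
have mf1 := real_moments_Lfun1 mf; have mg1 := real_moments_Lfun1 mg.
have -> : ('E_P[(fun w => f w + g w)%R] = 'E_P[f] + 'E_P[g])%E :=
  expectationD mf1 mg1.
by rewrite fineD ?expectation_fin_num.
Qed.

Lemma cE_cst c : cE P (fun=> c) = c.
Proof.
by apply: eq_cplx; rewrite /= -[X in expectation _ X]/(cst _) expectation_cst.
Qed.

Lemma cED X Y : has_all_moments P X -> has_all_moments P Y ->
  cE P (fun w => X w + Y w) = cE P X + cE P Y.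
Proof.
move=> /has_all_momentsE[Xr Xi] /has_all_momentsE[Yr Yi].
apply: eq_cplx; rewrite ?Re_cplxD ?Im_cplxD /=.
  by under eq_fun do rewrite Re_cplxD; rewrite real_ED.
by under eq_fun do rewrite Im_cplxD; rewrite real_ED.
Qed.

Lemma cEZ c X : has_all_moments P X -> cE P (fun w => c * X w) = c * cE P X.
Proof.
move=> /has_all_momentsE[Xr Xi]; apply: eq_cplx.
  rewrite Re_cplxM /=.
  under eq_fun do rewrite Re_cplxM mulrC -mulNr [- _ * _]mulrC.
  rewrite real_ED; [|exact: real_momentsZ..].
  by rewrite !real_EZ // mulrN mulrC [X in _ - X]mulrC.
rewrite Im_cplxM /=; under eq_fun do rewrite Im_cplxM mulrC [X in _ + X]mulrC.
rewrite real_ED; [|exact: real_momentsZ..].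
by rewrite !real_EZ // mulrC [X in _ + X]mulrC.
Qed.

Lemma cE_sum I (r : seq I) (c : I -> cplx R) (F : I -> T -> cplx R) :
  (forall i, has_all_moments P (F i)) ->
  cE P (fun w => \sum_(i <- r) c i * F i w) = \sum_(i <- r) c i * cE P (F i).
Proof.
move=> mF; have mcF i : has_all_moments P (fun w => c i * F i w).
  by apply: momentsM => //; apply: moments_cst.
elim: r => [|i r IH].
  by under eq_fun do rewrite big_nil; rewrite cE_cst big_nil.
under eq_fun do rewrite big_cons; rewrite cED ?big_cons ?IH ?cEZ //.
exact: moments_sum.
Qed.

Lemma cCovC X Y : cCov P X Y = cCov P Y X.
Proof.
by rewrite /cCov [cE P Y * _]mulrC; under eq_fun do rewrite mulrC.
Qed.

Lemma cCovDl X Y Z : has_all_moments P X -> has_all_moments P Y ->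
  has_all_moments P Z ->
  cCov P (fun w => X w + Y w) Z = cCov P X Z + cCov P Y Z.
Proof.
move=> mX mY mZ; rewrite /cCov; under eq_fun do rewrite mulrDl.
rewrite !cED ?mulrDl //; [|exact: momentsM..].
by rewrite opprD addrACA.
Qed.

Lemma cCov_cstl c Y : has_all_moments P Y -> cCov P (fun=> c) Y = 0.
Proof. by move=> mY; rewrite /cCov cEZ // cE_cst subrr. Qed.

Lemma cCov_addcstl c X Y : has_all_moments P X -> has_all_moments P Y ->
  cCov P (fun w => c + X w) Y = cCov P X Y.
Proof.
move=> mX mY; rewrite cCovDl ?cCov_cstl ?add0r //; exact: moments_cst.
Qed.

Lemma cCovZl c X Y : has_all_moments P X -> has_all_moments P Y ->
  cCov P (fun w => c * X w) Y = c * cCov P X Y.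
Proof.
move=> mX mY; rewrite /cCov; under eq_fun do rewrite -mulrA.
rewrite !cEZ //; last exact: momentsM.
by rewrite mulrBr mulrA.
Qed.

Lemma cCov_suml I (r : seq I) (c : I -> cplx R) (F : I -> T -> cplx R) Y :
  (forall i, has_all_moments P (F i)) -> has_all_moments P Y ->
  cCov P (fun w => \sum_(i <- r) c i * F i w) Y =
  \sum_(i <- r) c i * cCov P (F i) Y.
Proof.
move=> mF mY; have mcF i : has_all_moments P (fun w => c i * F i w).
  by apply: momentsM => //; apply: moments_cst.
elim: r => [|i r IH].
  by under eq_fun do rewrite big_nil; rewrite cCov_cstl // big_nil.
under eq_fun do rewrite big_cons; rewrite cCovDl ?big_cons ?IH ?cCovZl //.
exact: moments_sum.
Qed.

End Moments.

(** * Limits of expectations and covariances *)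

(** For limit moments [al] and [k, l >= 1], this is the limit of
    [E tr ((a^k - al_k) (a^l - al_l))]. *)
Definition momcov (K : pzRingType) (al : nat -> K) k l :=
  al (k + l)%N - al k * al l.

Section NumFieldLimits.
Variable K : numFieldType.

Lemma cvg_finsum I (r : seq I) (f : I -> nat -> K) (l : I -> K) :
  (forall i, f i N @[N --> \oo] --> l i) ->
  \sum_(i <- r) f i N @[N --> \oo] --> \sum_(i <- r) l i.
Proof. by move=> fl; apply: cvg_big => // x; exact: add_continuous. Qed.

Lemma eq_cvg_seq (f g : nat -> K) (l : K) : (forall N, f N = g N) ->
  g N @[N --> \oo] --> l -> f N @[N --> \oo] --> l.
Proof. by move=> /funext ->. Qed.

Lemma cvg_scale (f : nat -> K) (c l : K) :
  f N @[N --> \oo] --> l -> c * f N @[N --> \oo] --> c * l.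
Proof. by move=> fl; apply: cvgM => //; exact: cvg_cst. Qed.

Lemma cvg_num_unique (f : nat -> K) (l l' : K) :
  f N @[N --> \oo] --> l -> f N @[N --> \oo] --> l' -> l = l'.
Proof.
by move=> fl fl'; apply: (cvg_unique _ fl fl'); exact: norm_hausdorff.
Qed.

Lemma cvg_add (f g : nat -> K) (l l' : K) :
  f N @[N --> \oo] --> l -> g N @[N --> \oo] --> l' ->
  f N + g N @[N --> \oo] --> l + l'.
Proof. exact: cvgD. Qed.

Lemma cvg_size (c : K) : N%:R^-1 * (c *+ N) @[N --> \oo] --> c.
Proof.
(* At [N = 0] the left side is [0], so the sequence is constant only from [N = 1] on. *)
apply: cvg_near_cst; exists 1%N => // N /= N1.
by rewrite -[c *+ N]mulr_natl mulKf // pnatr_eq0 -lt0n.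
Qed.

End NumFieldLimits.

Section Limits.
Context (R : realType) (d : nat -> measure_display)
  (T : forall N, measurableType (d N)) (P : forall N, probability (T N) R).
Local Notation K := (cplx R).
Implicit Types X Y : forall N, T N -> K.

Definition moments_seq X := forall N, has_all_moments (P N) (X N).

(** Integrability of both arguments is part of the notion because bilinearity of the covariance
    depends on it. *)
Definition covlim X Y l := [/\ moments_seq X, moments_seq Y
  & cCov (P N) (X N) (Y N) @[N --> \oo] --> (l : K)].

Lemma covlimC X Y l : covlim X Y l -> covlim Y X l.
Proof. 
case=> mX mY XY; split; [exact: mY | exact: mX |].
by apply: eq_cvg_seq XY => N; rewrite cCovC.
Qed.

Lemma covlim_unique X Y l l' : covlim X Y l -> covlim X Y l' -> l = l'.
Proof. by case=> _ _ Xl [_ _ Xl']; apply: cvg_num_unique Xl Xl'. Qed.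

Lemma eq_covlim X Y X' Y' l : (forall N w, X N w = X' N w) ->
  (forall N w, Y N w = Y' N w) -> covlim X Y l -> covlim X' Y' l.
Proof.
move=> XX' YY'; rewrite (_ : X = X'); last first.
  by apply: functional_extensionality_dep => N; apply: funext => w; apply: XX'.
rewrite (_ : Y = Y') //.
by apply: functional_extensionality_dep => N; apply: funext => w; apply: YY'.
Qed.

Lemma covlim_addcstl (c : nat -> K) X Y l :
  covlim X Y l -> covlim (fun N w => c N + X N w) Y l.
Proof.
case=> mX mY XY; split; [|exact: mY|].
  by move=> N; apply: momentsD => //; apply: moments_cst.
by apply: eq_cvg_seq XY => N; rewrite cCov_addcstl.
Qed.

Lemma covlim_suml I (r : seq I) (c : I -> K) (X : I -> forall N, T N -> K) Y
    (l : I -> K) :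
  moments_seq Y -> (forall i, covlim (X i) Y (l i)) ->
  covlim (fun N w => \sum_(i <- r) c i * X i N w) Y (\sum_(i <- r) c i * l i).
Proof.
move=> mY XY; have mX i : moments_seq (X i) by case: (XY i).
split; [move=> N | exact: mY |].
  by apply: moments_sum => i _; apply: momentsM; [apply: moments_cst|apply: mX].
apply: eq_cvg_seq (fun N => cCov_suml _ _ (fun i => mX i N) (mY N)) _.
by apply: cvg_finsum => i; apply: cvg_scale; case: (XY i).
Qed.

Lemma covlim_sum2 I J (r : seq I) (s : seq J) (c : I -> K) (e : J -> K)
    (X : I -> forall N, T N -> K) (Y : J -> forall N, T N -> K)
    (l : I -> J -> K) :
  (forall i, moments_seq (X i)) -> (forall j, moments_seq (Y j)) ->
  (forall i j, covlim (X i) (Y j) (l i j)) ->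
  covlim (fun N w => \sum_(i <- r) c i * X i N w)
         (fun N w => \sum_(j <- s) e j * Y j N w)
         (\sum_(i <- r) c i * \sum_(j <- s) e j * l i j).
Proof.
move=> mX mY XY; apply: covlim_suml => [N|i].
  by apply: moments_sum => j _; apply: momentsM; [apply: moments_cst|apply: mY].
by apply/covlimC/covlim_suml => // j; apply/covlimC.
Qed.

Lemma covlimD X X' Y l l' : covlim X Y l -> covlim X' Y l' ->
  covlim (fun N w => X N w + X' N w) Y (l + l').
Proof.
case=> mX mY XY [mX' _ X'Y]; split; [by move=> N; apply: momentsD | exact: mY |].
by apply: eq_cvg_seq (fun N => cCovDl (mX N) (mX' N) (mY N)) _; apply: cvg_add.
Qed.

Definition explim X l := moments_seq X /\
  cE (P N) (fun w => N%:R^-1 * X N w) @[N --> \oo] --> (l : K).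

Lemma explim_unique X l l' : explim X l -> explim X l' -> l = l'.
Proof. by case=> _ Xl [_ Xl']; apply: cvg_num_unique Xl Xl'. Qed.

Lemma eq_explim X X' l :
  (forall N w, X N w = X' N w) -> explim X l -> explim X' l.
Proof.
move=> XX'; rewrite (_ : X = X') //.
by apply: functional_extensionality_dep => N; apply: funext => w; apply: XX'.
Qed.

Lemma explim_sum I (r : seq I) (c : I -> K) (X : I -> forall N, T N -> K)
    (l : I -> K) : (forall i, explim (X i) (l i)) ->
  explim (fun N w => \sum_(i <- r) c i * X i N w) (\sum_(i <- r) c i * l i).
Proof.
move=> Xl; have mX i : moments_seq (X i) by case: (Xl i).
have mNX i N : has_all_moments (P N) (fun w => N%:R^-1 * X i N w).
  by apply: momentsM; [apply: moments_cst | apply: mX].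
split=> [N|].
  by apply: moments_sum => i _; apply: momentsM; [apply: moments_cst|apply: mX].
apply: (@eq_cvg_seq _ _
  (fun N => \sum_(i <- r) c i * cE (P N) (fun w => N%:R^-1 * X i N w))) => [N|].
  rewrite -cE_sum //; congr cE; apply: funext => w.
  by rewrite mulr_sumr; apply: eq_bigr => i _; rewrite mulrCA.
by apply: cvg_finsum => i; apply: cvg_scale; case: (Xl i).
Qed.

Lemma explimD X X' l l' : explim X l -> explim X' l' ->
  explim (fun N w => X N w + X' N w) (l + l').
Proof.
case=> mX Xl [mX' Xl']; split=> [N|]; first exact: momentsD.
apply: (eq_cvg_seq _ (cvg_add Xl Xl')) => N; rewrite -cED.
  by congr cE; apply: funext => w; rewrite mulrDr.
  by apply: momentsM; [apply: moments_cst | apply: mX].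
  by apply: momentsM; [apply: moments_cst | apply: mX'].
Qed.

Lemma explim_size (c : K) : explim (fun N _ => c *+ N) c.
Proof.
split=> [N|]; first exact: moments_cst.
have cs := @cvg_size (cplx R) c.
by apply: (@eq_cvg_seq (cplx R) _ _ _ _ cs) => N; rewrite cE_cst.
Qed.

End Limits.

Section EnsembleLimits.
Context (R : realType) (d : nat -> measure_display)
  (T : forall N, measurableType (d N)) (P : forall N, probability (T N) R).
Local Notation K := (cplx R).
Implicit Types (A B : ensemble R T) (M : forall N, T N -> 'M[K]_N).

Definition mx_moments M :=
  forall N i j, has_all_moments (P N) (fun w => M N w i j).

Lemma mx_momentsM M M' : mx_moments M -> mx_moments M' ->
  mx_moments (fun N w => M N w * M' N w).
Proof.
move=> mM mM' N i j.
rewrite (_ : (fun w => _) = fun w => \sum_k M N w i k * M' N w k j); last first.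
  by apply: funext => w; rewrite mxE.
by apply: moments_sum => k _; apply: momentsM; [apply: mM | apply: mM'].
Qed.

Lemma mx_momentsD M M' : mx_moments M -> mx_moments M' ->
  mx_moments (fun N w => M N w + M' N w).
Proof.
move=> mM mM' N i j.
rewrite (_ : (fun w => _) = fun w => M N w i j + M' N w i j); last first.
  by apply: funext => w; rewrite mxE.
by apply: momentsD; [apply: mM | apply: mM'].
Qed.

Lemma mx_moments_cst (c : forall N, 'M[K]_N) : mx_moments (fun N _ => c N).
Proof. by move=> N i j; apply: moments_cst. Qed.

Lemma mx_moments_exp M k : mx_moments M -> mx_moments (fun N w => M N w ^+ k).
Proof.
move=> mM; elim: k => [|k IH].
  exact: (mx_moments_cst (fun N => 1)).
move=> N i j; under eq_fun do rewrite exprS.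
exact: (mx_momentsM mM IH).
Qed.

Lemma moments_trace M : mx_moments M -> moments_seq P (fun N w => \tr (M N w)).
Proof. by move=> mM N; apply: moments_sum => i _; apply: mM. Qed.

Lemma mx_moments_prod p (F : 'I_p -> forall N, T N -> 'M[K]_N) :
  (forall x, mx_moments (F x)) -> mx_moments (fun N w => \prod_x F x N w).
Proof.
elim: p F => [|p IH] F mF N i j.
  under eq_fun do rewrite big_ord0.
  exact: (mx_moments_cst (fun N => 1)).
under eq_fun do rewrite big_ord_recl.
exact: (mx_momentsM (mF ord0) (IH _ (fun x => mF (lift ord0 x)))).
Qed.

Lemma mx_moments_centered A k : random_matrices P A ->
  mx_moments (centered_pow P A k).
Proof.
move=> mA; apply: (mx_momentsD (mx_moments_exp k mA)).
exact: (mx_moments_cst (fun N => - (alpha P A k)%:M)).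
Qed.

Lemma moments_Tr_pow A k : random_matrices P A -> moments_seq P (Tr_pow A k).
Proof. by move=> mA; apply: moments_trace; apply: mx_moments_exp. Qed.

Lemma moments_alternating A B p n m : random_matrices P A ->
  random_matrices P B -> moments_seq P (Defs.alternating P A B p n m).
Proof.
move=> mA mB; apply: moments_trace.
apply: (@mx_moments_prod p (fun i N w =>
  centered_pow P A (n i) w * centered_pow P B (m i) w)) => x.
by apply: mx_momentsM; apply: mx_moments_centered.
Qed.

(** The two traces differ by a deterministic number, so covariances do not distinguish [Tr (A^k)]
    from the centered trace of the hypotheses. *)
Lemma Tr_pow_centered A k N (w : T N) :
  Tr_pow A k w = alpha P A k *+ N + \tr (centered_pow P A k w).
Proof. by rewrite raddfB /= mxtrace_scalar addrC subrK. Qed.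

Lemma covlim_Tr_pow A k l : random_matrices P A -> second_order_limit P A ->
  covlim P (Tr_pow A k.+1) (Tr_pow A l.+1) (alpha2 P A k.+1 l.+1).
Proof.
move=> mA sA; split; [exact: moments_Tr_pow..|].
exact: (sol_cov sA (isT : (1 <= k.+1)%N) (isT : (1 <= l.+1)%N)).
Qed.

Lemma explim_Tr_pow A k : random_matrices P A -> second_order_limit P A ->
  explim P (Tr_pow A k.+1) (alpha P A k.+1).
Proof.
move=> mA sA; split; first exact: moments_Tr_pow.
exact: (sol_moment sA (isT : (1 <= k.+1)%N)).
Qed.

Variables A B : ensemble R T.
Hypotheses (hA : random_matrices P A) (hB : random_matrices P B).
Hypothesis hfree2 : asymptotically_free2 P A B.
Hypothesis hfree : asymptotically_free P A B.
Hypothesis huncor : asymptotically_uncorrelated P A B.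

Lemma covlim_Tr_powAB k l : covlim P (Tr_pow A k.+1) (Tr_pow B l.+1) 0.
Proof.
apply: (@eq_covlim _ _ _ _
  (fun N w => alpha P A k.+1 *+ N + \tr (centered_pow P A k.+1 w)) _ _ _ 0) =>
  [N w | // |]; first by rewrite -Tr_pow_centered.
apply: covlim_addcstl; apply: covlimC.
apply: (@eq_covlim _ _ _ _
  (fun N w => alpha P B l.+1 *+ N + \tr (centered_pow P B l.+1 w)) _ _ _ 0) =>
  [N w | // |]; first by rewrite -Tr_pow_centered.
apply: covlim_addcstl; apply: covlimC.
split; [exact/moments_trace/mx_moments_centered..|].
exact: (af2_single hfree2).
Qed.

Lemma covlim_Tr_pow_alternating k p n m : (1 <= p)%N -> pos_seq n ->
  pos_seq m ->
  covlim P (Tr_pow A k.+1) (Defs.alternating P A B p n m) 0 /\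
  covlim P (Tr_pow B k.+1) (Defs.alternating P A B p n m) 0.
Proof.
move=> p1 n1 m1; have [uA uB] := huncor (isT : (1 <= k.+1)%N) p1 n1 m1.
have mAB := moments_alternating p n m hA hB; split.
  apply: (@eq_covlim _ _ _ _
    (fun N w => alpha P A k.+1 *+ N + \tr (centered_pow P A k.+1 w)) _ _ _ 0) =>
    [N w | // |]; first by rewrite -Tr_pow_centered.
  apply: covlim_addcstl.
  by split; [exact/moments_trace/mx_moments_centered | exact: mAB | exact: uA].
apply: (@eq_covlim _ _ _ _
  (fun N w => alpha P B k.+1 *+ N + \tr (centered_pow P B k.+1 w)) _ _ _ 0) =>
  [N w | // |]; first by rewrite -Tr_pow_centered.
apply: covlim_addcstl.
by split; [exact/moments_trace/mx_moments_centered | exact: mAB | exact: uB].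
Qed.

Lemma covlim_alternating_neq p q n m n' m' : (1 <= p)%N -> (1 <= q)%N ->
  p != q -> pos_seq n -> pos_seq m -> pos_seq n' -> pos_seq m' ->
  covlim P (Defs.alternating P A B p n m) (Defs.alternating P A B q n' m') 0.
Proof.
move=> p1 q1 pq n1 m1 n1' m1'; split; [exact: moments_alternating..|].
exact: (af2_neq hfree2).
Qed.

(** Second order freeness lists the indices of the second trace backwards. It is applied to the
    reversed sequences, whose second reversal gives back [n'] and [m'] below [p]. *)
Lemma covlim_alternating_eq p n m n' m' : (1 <= p)%N ->
  pos_seq n -> pos_seq m -> pos_seq n' -> pos_seq m' ->
  covlim P (Defs.alternating P A B p n m) (Defs.alternating P A B p n' m')
    (\sum_(k < p) \prod_(i < p)
      (momcov (alpha P A) (n ((i + k) %% p)%N) (rev_index p n' i)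
       * momcov (alpha P B) (m ((i + k) %% p)%N)
           (rev_index p m' (i.+1 %% p)%N))).
Proof.
move=> p1 n1 m1 n1' m1'; split; [exact: moments_alternating..|].
have rr (f : nat -> nat) i : (i < p)%N ->
    rev_index p (rev_index p f) i = f i.
  by move=> ip; rewrite /rev_index subKn //; case: (p) ip.
have rpos f : pos_seq f -> pos_seq (rev_index p f) by move=> f1 i; apply: f1.
have := af2_eq hfree2 p1 n1 m1 (rpos _ n1') (rpos _ m1').
apply: eq_cvg_seq => N; apply: (congr1 (cCov (P N) _)); apply: funext => w.
apply: (congr1 (@mxtrace _ _)); apply: eq_bigr => i _.
by rewrite !rr.
Qed.

Lemma explim_alternating p n m : (1 <= p)%N -> pos_seq n -> pos_seq m ->
  explim P (Defs.alternating P A B p n m) 0.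
Proof.
by move=> p1 n1 m1; split; [exact: moments_alternating | exact: hfree].
Qed.

End EnsembleLimits.

(** * Expansion of cyclic products *)

Section RotatedExpansion.
Variables (S : comNzRingType) (J : finType) (p : nat).
Variables (e e' f f' : J -> S) (a b : J -> J -> S).
Variables (s r t : 'I_p -> 'I_p).
Hypotheses (s_inj : injective s) (r_inj : injective r) (t_inj : injective t).

(** The right-hand side is a product of [p] independent sums, one per position. The bijections [s],
    [r], [t] of the positions only rename the summation variables, so a rotation hidden in [s] does
    not affect the value. *)
Lemma rotated_expansion :
  \sum_(F : {ffun 'I_p -> J * J}) \sum_(G : {ffun 'I_p -> J * J})
    (\prod_x (e (F x).1 * f (F x).2)) * (\prod_x (e' (G x).1 * f' (G x).2)) *
    \prod_x (a (F (s x)).1 (G (r x)).1 * b (F (s x)).2 (G (t x)).2) =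
  ((\sum_u \sum_v e u * e' v * a u v) *
   (\sum_u \sum_v f u * f' v * b u v)) ^+ p.
Proof.
pose E (U V : J * J) := (e U.1 * f U.2) * (e' V.1 * f' V.2) *
  (a U.1 V.1 * b U.2 V.2).
have -> : (\sum_u \sum_v e u * e' v * a u v) *
    (\sum_u \sum_v f u * f' v * b u v) = \sum_U \sum_V E U V.
  rewrite big_distrlr pair_bigA; apply: eq_bigr => U _ /=.
  rewrite big_distrlr pair_bigA; apply: eq_bigr => V _ /=.
  by rewrite /E; ring.
rewrite -[X in _ ^+ X]card_ord -prodr_const bigA_distr_bigA /=.
have surj (h : 'I_p -> 'I_p) : injective h -> forall y, exists x, y = h x.
  by move=> /injF_bij [g _ gK] y; exists (g y); rewrite gK.
pose hF (F : {ffun 'I_p -> J * J}) := [ffun x => F (s x)].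
(* The two exponents at a position of [G] move by different permutations: the freeness formula pairs
   [n(i + k)] with index [i], but [m(i + k)] with index [i + 1]. *)
pose hG (G : {ffun 'I_p -> J * J}) := [ffun x => ((G (r x)).1, (G (t x)).2)].
have hF_inj : injective hF.
  move=> F1 F2 e12; apply/ffunP => y; have [x ->] := surj s s_inj y.
  by have /ffunP/(_ x) := e12; rewrite !ffunE.
have hG_inj : injective hG.
  move=> G1 G2 e12; apply/ffunP => y.
  have [x1 yx1] := surj r r_inj y; have [x2 yx2] := surj t t_inj y.
  have /ffunP/(_ x1) := e12; have /ffunP/(_ x2) := e12.
  rewrite !ffunE -yx1 -yx2 => -[_ e2] [e1 _].
  by rewrite [G1 y]surjective_pairing e1 e2 -surjective_pairing.
rewrite [RHS](reindex_inj hF_inj); apply: eq_bigr => F _ /=.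
rewrite bigA_distr_bigA [RHS](reindex_inj hG_inj); apply: eq_bigr => G _ /=.
rewrite [X in X * _ * _](reindex_inj s_inj) /=.
rewrite [X in _ * X * _]big_split /= [X in _ * (X * _) * _](reindex_inj r_inj).
rewrite [X in _ * (_ * X) * _](reindex_inj t_inj) -!big_split /=.
by apply: eq_bigr => x _; rewrite /E !ffunE.
Qed.

End RotatedExpansion.

(** * Truncation of bivariate series *)

Section BivariateCongruence.
Variable R : comNzRingType.
Implicit Types (f g h : fps R) (F G : fps (fps R)).

Definition eqfps2 n F G :=
  forall i j, (i < n)%N -> (j < n)%N -> F i j = G i j.

Lemma eqfps2_refl n F : eqfps2 n F F. Proof. by []. Qed.

Lemma eqfps2M n F F' G G' :
  eqfps2 n F F' -> eqfps2 n G G' -> eqfps2 n (F * G) (F' * G').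
Proof.
move=> eF eG i j lin ljn; rewrite !fps_coefM !fps_coef_sum.
apply: eq_bigr => k _; rewrite !fps_coefM; apply: eq_bigr => l _.
have lt_le m (x : 'I_m.+1) : (m < n)%N -> (x < n)%N.
  by apply: leq_ltn_trans; rewrite -ltnS.
by rewrite eF ?eG ?lt_le // (leq_ltn_trans (leq_subr _ _)).
Qed.

Lemma eqfps2_exp n F G p : eqfps2 n F G -> eqfps2 n (F ^+ p) (G ^+ p).
Proof. move=> e; elim: p => [|p IH]; first exact: eqfps2_refl.
by rewrite !exprS; apply: eqfps2M. Qed.

Definition cst2 (c : R) : fps (fps R) := fps_inx (fpsC c).

Lemma fps_coef_inxy_cst2 f g c i j :
  (fps_inx f * fps_iny g * cst2 c) i j = f i * g j * c.
Proof.
rewrite mulrAC -rmorphM fps_coef_inxy [f * _]mulrC fps_coefCM.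
by rewrite -mulrA mulrC.
Qed.

Lemma fps_coef2_sum I (r : seq I) (F : I -> fps (fps R)) i j :
  (\sum_(k <- r) F k) i j = \sum_(k <- r) F k i j.
Proof. by rewrite !fps_coef_sum. Qed.

Lemma eqfps_subst2 h (h0 : h 0 = 0) F n :
  eqfps2 n (fps_subst2 h0 F) (\sum_(k < n) \sum_(l < n)
    fps_inx (h ^+ k) * fps_iny (h ^+ l) * cst2 (F k l)).
Proof.
move=> i j lin ljn; rewrite fps_coef2_sum /fps_subst2.
rewrite (@eqfps_subst _ _ _ n) // fps_coef2_sum; apply: eq_bigr => k _.
rewrite fps_coef_map -rmorphXn -fps_inyE mulrC fps_coef_inxy.
rewrite (@eqfps_subst _ _ _ n) // fps_coef_sum mulr_sumr fps_coef2_sum.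
apply: eq_bigr => l _; rewrite fps_coef_inxy_cst2 fps_coefCM.
by rewrite [F k l * _]mulrC mulrA.
Qed.

Lemma eqfps2_subst2 f g h (h0 : h 0 = 0) F n :
  eqfps2 n (fps_inx f * fps_iny g * fps_subst2 h0 F)
    (\sum_(k < n) \sum_(l < n)
      fps_inx (f * h ^+ k) * fps_iny (g * h ^+ l) * cst2 (F k l)).
Proof.
move=> i j lin ljn.
rewrite (eqfps2M (@eqfps2_refl n _) (@eqfps_subst2 h h0 F n)) //.
congr (fps_coef (fps_coef _ _) _); rewrite mulr_sumr; apply: eq_bigr => k _.
rewrite mulr_sumr; apply: eq_bigr => l _.
by rewrite !rmorphM mulrA mulrACA.
Qed.

End BivariateCongruence.

(** * The series [X], [Y] of the overview and [log (1 - X Y)] *)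

Section PairSeries.
Variable K : numFieldType.
Implicit Types (C : fps K) (al : nat -> K).

(** The series [X] (or [Y]): the sum of [weight C k] in [t] times [weight C l] in [s] times
    [momcov al k l]. The use of [series1 al] makes the zeroth moment [1], so that terms with [k = 0]
    or [l = 0] vanish. *)
Definition pair_series C al : fps (fps K) :=
  fps_inx C^-1 * fps_iny C^-1 * fps_subst2 (fps_divX_coef0 C)
    (FPS (fun k => FPS (fun l => momcov (series1 al) k l))).

Lemma pair_series_trunc I C al : eqfps2 I.+1 (pair_series C al)
  (\sum_(u < I) \sum_(v < I) fps_inx (weight C u.+1) *
     fps_iny (weight C v.+1) * cst2 (momcov al u.+1 v.+1)).
Proof.
move=> i j li lj; rewrite (@eqfps2_subst2 _ _ _ _ _ _ I.+1) //.
congr (fps_coef (fps_coef _ _) _).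
have c0 : cst2 (0 : K) = 0 by rewrite /cst2 !rmorph0.
have m0l l : momcov (series1 al) 0 l = 0 by rewrite /momcov add0n mul1r subrr.
have mk0 k : momcov (series1 al) k 0 = 0 by rewrite /momcov addn0 mulr1 subrr.
rewrite big_ord_recl [X in X + _]big1 ?add0r => [|l _]; last first.
  by rewrite [FPS _ _]m0l c0 mulr0.
apply: eq_bigr => u _; rewrite big_ord_recl [X in X + _](_ : _ = 0) ?add0r //.
by rewrite [FPS _ _]mk0 c0 mulr0.
Qed.

Lemma pair_series_coef0 C al : pair_series C al 0 = 0.
Proof.
apply: fpsP => j; rewrite (@pair_series_trunc j) // fps_coef2_sum.
rewrite big1 // => u _; rewrite fps_coef2_sum big1 // => v _.
rewrite fps_coef_inxy_cst2 /weight fps_coef0M exprS fps_coef0M.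
by rewrite fps_divX_coef0 mul0r mulr0 !mul0r.
Qed.

Lemma pair_product_coef0 C al C' al' :
  (pair_series C al * pair_series C' al') 0 = 0.
Proof.
move: (pair_series_coef0 C al); move: (pair_series C al) (pair_series _ _).
by move=> F G F0; rewrite fps_coef0M F0 mul0r.
Qed.

(** [- log (1 - w)], with the junk value [0^-1 = 0] as its constant term. *)
Definition log_series : fps (fps K) :=
  fps_map fpsC (FPS (fun n => n%:R^-1)).

Lemma coef_log_series (w : fps (fps K)) (w0 : w 0 = 0) i j m : (i <= m)%N ->
  fps_subst w0 log_series i j = \sum_(p < m) p.+1%:R^-1 * (w ^+ p.+1) i j.
Proof.
move=> im; rewrite (@eqfps_subst _ _ _ m.+1) // fps_coef2_sum big_ord_recl.
rewrite -[log_series ord0]/(fpsC (0^-1)) invr0 rmorph0 rmorph0 mul0r add0r.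
by apply: eq_bigr => p _; rewrite fps_coefCM fps_coefCM.
Qed.

Lemma coef_mul_subst C (g : fps K) (c : nat -> K) i n : (i < n)%N ->
  (g * fps_subst (fps_divX_coef0 C) (FPS c)) i =
  \sum_(k < n) (g * (fpsX / C) ^+ k) i * c k.
Proof.
move=> lin; rewrite (eqfpsM (@eqfps_refl _ n g) (@eqfps_subst _ _ _ n _)) //.
rewrite mulr_sumr fps_coef_sum; apply: eq_bigr => k _.
by rewrite mulrCA fps_coefCM mulrC.
Qed.

End PairSeries.

Section SeriesLimits.
Context (R : realType) (d : nat -> measure_display)
  (T : forall N, measurableType (d N)) (P : forall N, probability (T N) R).
Local Notation K := (cplx R).
Implicit Types (C : fps K) (A B : ensemble R T).

Definition log_deriv_rv (C : fps K) (A : ensemble R T) i N : T N -> K :=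
  fun w => (\tr (deriv_mx (pencil C (A N w)) * resolvent C (A N w))) i.

Lemma log_deriv_rvE C A i n N (w : T N) : C 0 = 1 -> (i < n)%N ->
  log_deriv_rv C A i w = (fps_deriv C / C) i *+ N +
    \sum_(k < n) - (fps_deriv (fpsX / C) * (fpsX / C) ^+ k) i *
      Tr_pow A k.+1 w.
Proof.
move=> C0 lin; rewrite /log_deriv_rv log_deriv_pencil // fps_coefB fps_coefMn.
rewrite (coef_mul_subst _ _ _ lin); congr (_ + _); rewrite -sumrN.
apply: eq_bigr => k _.
by rewrite mulNr.
Qed.

(** The limit covariance of two log-derivatives: each contributes [- h' sum_k h^k tr (a^(k+1))], and
    the signs cancel. Here [Rtransform2] merely shifts the indices of the moments. *)
Definition cov_series (C : fps K) (A : ensemble R T) : fps (fps K) :=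
  fps_inx (fps_deriv (fpsX / C)) * fps_iny (fps_deriv (fpsX / C)) *
  fps_subst2 (fps_divX_coef0 C) (Rtransform2 (alpha2 P A)).

Lemma covlim_log_deriv C A i j : C 0 = 1 -> random_matrices P A ->
  second_order_limit P A ->
  covlim P (log_deriv_rv C A i) (log_deriv_rv C A j) (cov_series C A i j).
Proof.
move=> C0 mA sA; pose n := (maxn i j).+1.
have lin : (i < n)%N by rewrite ltnS leq_maxl.
have ljn : (j < n)%N by rewrite ltnS leq_maxr.
apply: (@eq_covlim _ _ _ _
  (fun N w => _) (fun N w => _) _ _ _
  (fun N w => esym (log_deriv_rvE A w C0 lin))
  (fun N w => esym (log_deriv_rvE A w C0 ljn))).
apply: covlim_addcstl; apply: covlimC; apply: covlim_addcstl; apply: covlimC.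
have mT k : moments_seq P (Tr_pow A k) by exact: moments_Tr_pow.
have := covlim_sum2 (index_enum 'I_n) (index_enum 'I_n)
  (fun k : 'I_n => - (fps_deriv (fpsX / C) * (fpsX / C) ^+ k) i)
  (fun k : 'I_n => - (fps_deriv (fpsX / C) * (fpsX / C) ^+ k) j)
  (fun k : 'I_n => mT k.+1) (fun k : 'I_n => mT k.+1)
  (fun k l : 'I_n => covlim_Tr_pow k l mA sA).
congr covlim.
rewrite (@eqfps2_subst2 _ _ _ _ _ _ n) // fps_coef2_sum; apply: eq_bigr => k _.
rewrite mulr_sumr fps_coef2_sum; apply: eq_bigr => l _.
by rewrite fps_coef_inxy_cst2 !mulNr mulrN opprK mulrA.
Qed.

End SeriesLimits.

(** * First order *)

Section MomentSeries.
Variable K : fieldType.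
Implicit Types (C : fps K) (al : nat -> K).

(** The limit of [E tr ((C(t) - t a)' (C(t) - t a)^-1)] when [a] has
    moments [al]. *)
Definition log_deriv_series C al : fps K := fps_deriv C / C -
  fps_deriv (fpsX / C) *
    fps_subst (fps_divX_coef0 C) (FPS (fun k => al k.+1)).

Lemma fps_subst_series1 C al : fps_subst (fps_divX_coef0 C) (series1 al) =
  1 + fpsX / C * fps_subst (fps_divX_coef0 C) (FPS (fun k => al k.+1)).
Proof.
have -> : series1 al = 1 + fpsX * FPS (fun k => al k.+1).
  exact: series1_Rtransform.
by rewrite rmorphD rmorph1 rmorphM /= fps_substX.
Qed.

(** Multiplying by [x C] removes the inverses, and the moments then enter only through
    [m = M(x / C)]. *)
Lemma mulX_log_deriv_series C al : C 0 = 1 ->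
  fpsX * log_deriv_series C al * C =
  fpsX * fps_deriv C * fps_subst (fps_divX_coef0 C) (series1 al)
  - (fps_subst (fps_divX_coef0 C) (series1 al) - 1) * C.
Proof.
move=> C0; have CU := fps_unit1 C0.
rewrite fps_subst_series1 /log_deriv_series fps_deriv_divX //.
set n := fps_subst _ _; set D := fps_deriv C.
have -> : fpsX = fpsX / C * C by rewrite mulrVK.
set h := fpsX / C; rewrite mulrK // -/h.
have -> : h * C * (D / C - (C^-1 - h * (D / C)) * n) * C =
  h * C * (D / C * C) - h * C * (C^-1 * C) * n + h * C * h * (D / C * C) * n.
  by ring.
by rewrite (mulrVK CU D) (mulVr CU); ring.
Qed.

(** For a series [D] with [M(x / D) = D] the preceding identity reads [x L = x D' - (D - 1)], which
    is additive in [D - 1]. For the sum it then gives [(m - C) (x C' - C) = 0], where the second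
    factor has constant term [-1]. *)
Lemma log_deriv_seriesD (CA CB : fps K) (al be ga : nat -> K) :
  CA 0 = 1 -> CB 0 = 1 ->
  let C := CA + CB - 1 in
  fps_subst (fps_divX_coef0 CA) (series1 al) = CA ->
  fps_subst (fps_divX_coef0 CB) (series1 be) = CB ->
  log_deriv_series C ga = log_deriv_series CA al + log_deriv_series CB be ->
  fps_subst (fps_divX_coef0 C) (series1 ga) = C.
Proof.
move=> A0 B0 C mA mB lE.
have C0 : C 0 = 1 by rewrite /C fps_coefB fps_coefD A0 B0 addrK.
have self (D : fps K) al' :
    D 0 = 1 -> fps_subst (fps_divX_coef0 D) (series1 al') = D ->
    fpsX * log_deriv_series D al' = fpsX * fps_deriv D - (D - 1).
  move=> D0 mD; apply: (mulIr (fps_unit1 D0)).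
  by rewrite mulX_log_deriv_series // mD [RHS]mulrBl.
have eX : fpsX * log_deriv_series C ga = (fpsX * fps_deriv CA - (CA - 1)) +
    (fpsX * fps_deriv CB - (CB - 1)).
  rewrite lE mulrDr [X in X + _ = _](self _ _ A0 mA).
  by rewrite [X in _ + X = _](self _ _ B0 mB).
have := mulX_log_deriv_series ga C0; rewrite {}eX.
move: (fps_subst _ _) => m.
have -> : fps_deriv CA = fps_deriv C - fps_deriv CB.
  by rewrite /C raddfB raddfD /= fps_deriv1 subr0 addrK.
move=> e.
have : (m - C) * (fpsX * fps_deriv C - C) = 0.
  have : (fpsX * (fps_deriv C - fps_deriv CB) - (CA - 1) +
     (fpsX * fps_deriv CB - (CB - 1))) * C -
     (fpsX * fps_deriv C * m - (m - 1) * C) = 0 by rewrite e subrr.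
  move=> e0; rewrite -[RHS]oppr0 -e0 /C; ring.
move/eqP; rewrite mulf_eq0 subr_eq0 => /orP[/eqP //|/eqP].
move=> /(congr1 (fun f => fps_coef f 0)).
rewrite fps_coefB fps_coefXM0 C0 sub0r => /eqP.
by rewrite oppr_eq0 oner_eq0.
Qed.

End MomentSeries.

(** * Covariances of the resolvents *)

Lemma log_deriv_pencilD (K : numFieldType) N (a b : 'M[K]_N) (CA CB : fps K)
    (al be : nat -> K) i m :
  CA 0 = 1 -> CB 0 = 1 ->
  fps_subst (fps_divX_coef0 CA) (series1 al) = CA ->
  fps_subst (fps_divX_coef0 CB) (series1 be) = CB -> (i < m)%N ->
  (\tr (deriv_mx (pencil (CA + CB - 1) (a + b)) *
        resolvent (CA + CB - 1) (a + b))) i =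
  (\tr (deriv_mx (pencil CA a) * resolvent CA a)) i +
  (\tr (deriv_mx (pencil CB b) * resolvent CB b)) i +
  \sum_(p < m) - (i.+1%:R / p.+1%:R) *
    (\tr (((resolvent CA a - 1) * (resolvent CB b - 1)) ^+ p.+1)) i.+1.
Proof.
move=> A0 B0 mA mB im.
have C0 : (CA + CB - 1) 0 = 1 by rewrite fps_coefB fps_coefD A0 B0 addrK.
have PAU := resolventP a A0; have PBV := resolventP b B0.
have := resolventP (a + b) C0; have := resolvent_coef0 a A0 mA.
rewrite -pencilD; move: (resolvent (CA + CB - 1) (a + b)) => S.
move: (pencil CA a) (resolvent CA a) (pencil CB b) (resolvent CB b) PAU PBV.
move=> PA U PB V PAU PBV U0 PCS.
have Q0 k l : ((U - 1) * (V - 1)) k l 0 = 0.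
  by rewrite mxE fps_coef_sum big1 // => x _; rewrite fps_coef0M U0 mul0r.
have e := congr1 (fun f : fps K => f i) (log_deriv_alternating PAU PBV PCS).
rewrite [LHS]e fps_coefB fps_coefD; congr (_ + _).
rewrite (trace_log_coef im (one_sub_alternatingK PAU PBV PCS) Q0).
by rewrite -sumrN; apply: eq_bigr => p _; rewrite mulNr.
Qed.

Section FreeSeries.
Context (R : realType) (d : nat -> measure_display)
  (T : forall N, measurableType (d N)) (P : forall N, probability (T N) R).
Local Notation K := (cplx R).
Variables A B : ensemble R T.
Hypotheses (hA : random_matrices P A) (hB : random_matrices P B).
Hypothesis hfree2 : asymptotically_free2 P A B.
Hypothesis hfree : asymptotically_free P A B.
Hypothesis huncor : asymptotically_uncorrelated P A B.
Variables CA CB : fps K.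
Hypotheses (A0 : CA 0 = 1) (B0 : CB 0 = 1).
Hypothesis mA : fps_subst (fps_divX_coef0 CA) (series1 (alpha P A)) = CA.
Hypothesis mB : fps_subst (fps_divX_coef0 CB) (series1 (alpha P B)) = CB.

Definition alternating_rv p i N : T N -> K := fun w =>
  (\tr (((resolvent CA (@A N w) - 1) * (resolvent CB (@B N w) - 1)) ^+ p.+1)) i.

Local Notation index_fun p I := {ffun 'I_p.+1 -> 'I_I * 'I_I}.

(** Alternating traces take sequences on all of [nat], positive everywhere; [inord] extends [F]
    beyond its [p.+1] positions by values that are still successors. *)
Definition left_exponents p I (F : index_fun p I) : nat -> nat :=
  fun x => (F (inord x)).1.+1.
Definition right_exponents p I (F : index_fun p I) : nat -> nat :=
  fun x => (F (inord x)).2.+1.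
Definition index_weight p I (F : index_fun p I) : fps K :=
  \prod_x (weight CA (F x).1.+1 * weight CB (F x).2.+1).

Lemma left_exponents_pos p I (F : index_fun p I) : pos_seq (left_exponents F).
Proof. by []. Qed.
Lemma right_exponents_pos p I (F : index_fun p I) : pos_seq (right_exponents F).
Proof. by []. Qed.

Lemma alternating_rvE p i I N (w : T N) : (i <= I)%N ->
  alternating_rv p i w = \sum_(F : index_fun p I) index_weight F i *
    Defs.alternating P A B p.+1 (left_exponents F) (right_exponents F) w.
Proof.
move=> iI; rewrite /alternating_rv (trace_alternating_coef _ _ _ A0 B0 mA mB iI).
apply: eq_bigr => F _.
have -> : Defs.alternating P A B p.+1 (left_exponents F) (right_exponents F) w
  = \tr (\prod_x (centered_mx (alpha P A) (A w) (F x).1.+1 *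
                   centered_mx (alpha P B) (B w) (F x).2.+1)).
  apply: (congr1 (@mxtrace _ _)); apply: eq_bigr => x _.
  by rewrite /left_exponents /right_exponents inord_val.
by [].
Qed.

Lemma explim_alternating_rv p i : explim P (alternating_rv p i) 0.
Proof.
have := explim_sum (index_enum (index_fun p i)) (fun F => index_weight F i)
  (fun F => explim_alternating hA hB hfree (isT : (1 <= p.+1)%N)
     (left_exponents_pos F) (right_exponents_pos F)).
rewrite big1 => [|F _]; last by rewrite mulr0.
by apply: eq_explim => N w; rewrite (alternating_rvE _ _ (leqnn i)).
Qed.

Lemma moments_alternating_rv p i : moments_seq P (alternating_rv p i).
Proof. by case: (explim_alternating_rv p i). Qed.

Lemma covlim_log_deriv_alternating p i j :
  covlim P (log_deriv_rv CA A i) (alternating_rv p j) 0 /\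
  covlim P (log_deriv_rv CB B i) (alternating_rv p j) 0.
Proof.
have un k F := covlim_Tr_pow_alternating hA hB huncor k (isT : (1 <= p.+1)%N)
  (@left_exponents_pos p j F) (@right_exponents_pos p j F).
have alt F := moments_alternating p.+1 (@left_exponents p j F)
  (@right_exponents p j F) hA hB.
have aux (C : fps K) (E : ensemble R T) : C 0 = 1 -> random_matrices P E ->
    (forall k F, covlim P (Tr_pow E k.+1) (Defs.alternating P A B p.+1
        (@left_exponents p j F) (@right_exponents p j F)) 0) ->
    covlim P (log_deriv_rv C E i) (alternating_rv p j) 0.
  move=> C0 mE unE.
  have := covlim_sum2 (index_enum 'I_i.+1) (index_enum (index_fun p j))
    (fun k : 'I_i.+1 => - (fps_deriv (fpsX / C) * (fpsX / C) ^+ k) i)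
    (fun F => index_weight F j)
    (fun k : 'I_i.+1 => moments_Tr_pow k.+1 mE) alt
    (fun (k : 'I_i.+1) F => unE k F).
  rewrite big1 => [|k _]; last first.
    by rewrite big1 ?mulr0 // => F _; rewrite mulr0.
  move/(covlim_addcstl (fun N => (fps_deriv C / C) i *+ N)).
  apply: eq_covlim => N w; first by rewrite (log_deriv_rvE _ _ C0 (ltnSn i)).
  by rewrite (alternating_rvE _ _ (leqnn j)).
split; apply: aux => // k F; first by case: (un k F).
by case: (un k F).
Qed.

Lemma covlim_log_derivAB i j :
  covlim P (log_deriv_rv CA A i) (log_deriv_rv CB B j) 0.
Proof.
have := covlim_sum2 (index_enum 'I_i.+1) (index_enum 'I_j.+1)
  (fun k : 'I_i.+1 => - (fps_deriv (fpsX / CA) * (fpsX / CA) ^+ k) i)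
  (fun k : 'I_j.+1 => - (fps_deriv (fpsX / CB) * (fpsX / CB) ^+ k) j)
  (fun k : 'I_i.+1 => moments_Tr_pow k.+1 hA)
  (fun k : 'I_j.+1 => moments_Tr_pow k.+1 hB)
  (fun (k : 'I_i.+1) (l : 'I_j.+1) => covlim_Tr_powAB hA hB hfree2 k l).
rewrite big1 => [|k _]; last by rewrite big1 ?mulr0 // => l _; rewrite mulr0.
move/(covlim_addcstl (fun N => (fps_deriv CA / CA) i *+ N)) => /covlimC.
move/(covlim_addcstl (fun N => (fps_deriv CB / CB) j *+ N)) => /covlimC.
apply: eq_covlim => N w; first by rewrite (log_deriv_rvE _ _ A0 (ltnSn i)).
by rewrite (log_deriv_rvE _ _ B0 (ltnSn j)).
Qed.

Let W := pair_series CA (alpha P A) * pair_series CB (alpha P B).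

(** Only equal lengths survive; then each of the [p.+1] rotations in the freeness formula
    contributes the same coefficient of [W ^+ p.+1]. *)
Lemma covlim_alternating_rv p q i j :
  covlim P (alternating_rv p i) (alternating_rv q j)
    (if p == q then p.+1%:R * (W ^+ p.+1) i j else 0).
Proof.
pose I := maxn i j.
have iI : (i <= I)%N by rewrite leq_maxl.
have jI : (j <= I)%N by rewrite leq_maxr.
have alt s F := moments_alternating s.+1 (@left_exponents s I F)
  (@right_exponents s I F) hA hB.
case: (eqVneq p q) => [<- {q}|pq]; last first.
  have := covlim_sum2 (index_enum (index_fun p I)) (index_enum (index_fun q I))
    (fun F => index_weight F i) (fun F => index_weight F j)
    (alt p) (alt q) (fun F G => covlim_alternating_neq hA hB hfree2
      (isT : (1 <= p.+1)%N) (isT : (1 <= q.+1)%N) pq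
      (left_exponents_pos F) (right_exponents_pos F)
      (left_exponents_pos G) (right_exponents_pos G)).
  rewrite big1 => [|F _]; last first.
    by rewrite big1 ?mulr0 // => G _; rewrite mulr0.
  apply: eq_covlim => N w; first by rewrite (alternating_rvE _ _ iI).
  by rewrite (alternating_rvE _ _ jI).
have := covlim_sum2 (index_enum (index_fun p I)) (index_enum (index_fun p I))
  (fun F => index_weight F i) (fun F => index_weight F j)
  (alt p) (alt p) (fun F G => covlim_alternating_eq hA hB hfree2
    (isT : (1 <= p.+1)%N)
    (left_exponents_pos F) (right_exponents_pos F)
    (left_exponents_pos G) (right_exponents_pos G)).
set l := (X in covlim _ _ _ X).
suff -> : l = p.+1%:R * (W ^+ p.+1) i j.
  apply: eq_covlim => N w; first by rewrite (alternating_rvE _ _ iI).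
  by rewrite (alternating_rvE _ _ jI).
have {l} -> : l = \sum_(k < p.+1) (W ^+ p.+1) i j.
  rewrite {}/l.
  under eq_bigr do under eq_bigr do rewrite mulr_sumr.
  under eq_bigr do rewrite exchange_big mulr_sumr.
  rewrite exchange_big; apply: eq_bigr => k _.
  under eq_bigr do rewrite mulr_sumr.
  (* The positions in the freeness formula: [s] is the rotation by [k], [r] the reversal from
     [rev_index], and [t] the same reversal after a shift by one. *)
  pose s (x : 'I_p.+1) : 'I_p.+1 := inord ((x + k) %% p.+1).
  pose r (x : 'I_p.+1) : 'I_p.+1 := inord (p - x).
  pose t (x : 'I_p.+1) : 'I_p.+1 := inord (p - x.+1 %% p.+1).
  have s_inj : injective s.
    move=> x y /(congr1 val); rewrite /= !inordK ?ltn_pmod // => /eqP.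
    by rewrite eqn_modDr !modn_small // => /eqP /val_inj.
  have sub_inj m n : (m < p.+1)%N -> (n < p.+1)%N ->
      inord (p - m) = inord (p - n) :> 'I_p.+1 -> m = n.
    move=> mp np /(congr1 val); rewrite /= !inordK ?ltnS ?leq_subr // => e.
    by rewrite -(subKn (mp : m <= p)%N) e subKn.
  have r_inj : injective r.
    by move=> x y /sub_inj => /(_ (ltn_ord x) (ltn_ord y)) /val_inj.
  have t_inj : injective t.
    move=> x y /sub_inj; rewrite !ltn_pmod // => /(_ isT isT) /eqP.
    by rewrite -(addn1 x) -(addn1 y) eqn_modDr !modn_small // => /eqP /val_inj.
  have eW := eqfps2_exp p.+1 (eqfps2M (@pair_series_trunc _ I CA (alpha P A))
    (@pair_series_trunc _ I CB (alpha P B))).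
  rewrite [RHS]eW // -(rotated_expansion _ _ _ _ _ _ s_inj r_inj t_inj).
  rewrite fps_coef2_sum; apply: eq_bigr => F _.
  rewrite fps_coef2_sum; apply: eq_bigr => G _.
  have inxE : \prod_x (fps_inx (weight CA (F x).1.+1) *
      fps_inx (weight CB (F x).2.+1)) = fps_inx (index_weight F).
    by rewrite rmorph_prod; apply: eq_bigr => x _; rewrite rmorphM.
  have inyE : \prod_x (fps_iny (weight CA (G x).1.+1) *
      fps_iny (weight CB (G x).2.+1)) = fps_iny (index_weight G).
    by rewrite rmorph_prod; apply: eq_bigr => x _; rewrite rmorphM.
  rewrite [X in X * _ * _]inxE [X in _ * X * _]inyE.
  pose c x := momcov (alpha P A) (F (s x)).1.+1 (G (r x)).1.+1 *
    momcov (alpha P B) (F (s x)).2.+1 (G (t x)).2.+1.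
  have cE : \prod_x (cst2 (momcov (alpha P A) (F (s x)).1.+1 (G (r x)).1.+1) *
      cst2 (momcov (alpha P B) (F (s x)).2.+1 (G (t x)).2.+1))
      = cst2 (\prod_x c x).
    by rewrite /cst2 !rmorph_prod; apply: eq_bigr => x _; rewrite !rmorphM.
  by rewrite [X in _ = fps_coef (fps_coef (_ * X) _) _]cE fps_coef_inxy_cst2
    -mulrA.
by rewrite sumr_const card_ord mulr_natl.
Qed.

Let AB := ensemble_add A B.
Let C := CA + CB - 1.
Hypothesis hAB : second_order_limit P AB.

Let C0 : C 0 = 1.
Proof. by rewrite fps_coefB fps_coefD A0 B0 addrK. Qed.

Lemma random_matrices_add : random_matrices P AB.
Proof. exact: mx_momentsD. Qed.

Lemma log_deriv_rvD i m N (w : T N) : (i < m)%N ->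
  log_deriv_rv C AB i w = log_deriv_rv CA A i w + log_deriv_rv CB B i w +
    \sum_(p < m) - (i.+1%:R / p.+1%:R) * alternating_rv p i.+1 w.
Proof.
move=> im; exact: (log_deriv_pencilD (@A N w) (@B N w) A0 B0 mA mB im).
Qed.

Lemma explim_log_deriv (D : fps K) (E : ensemble R T) i : D 0 = 1 ->
  random_matrices P E -> second_order_limit P E ->
  explim P (log_deriv_rv D E i) (log_deriv_series D (alpha P E) i).
Proof.
move=> D0 mE sE.
have := explim_sum (index_enum 'I_i.+1)
  (fun k : 'I_i.+1 => - (fps_deriv (fpsX / D) * (fpsX / D) ^+ k) i)
  (fun k : 'I_i.+1 => explim_Tr_pow k mE sE).
move/(explimD (explim_size P ((fps_deriv D / D) i))).
rewrite /log_deriv_series fps_coefB (coef_mul_subst _ _ _ (ltnSn i)) -sumrN.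
under [X in explim _ _ (_ + X) -> _]eq_bigr do rewrite mulNr.
by apply: eq_explim => N w; rewrite (log_deriv_rvE _ _ D0 (ltnSn i)).
Qed.

(** In expectation every alternating trace vanishes, so the limit log-derivatives add, as
    [log_deriv_seriesD] requires. *)
Lemma moment_series_add :
  fps_subst (fps_divX_coef0 C) (series1 (alpha P AB)) = C.
Proof.
apply: (log_deriv_seriesD A0 B0 mA mB); apply: fpsP => i.
apply: (explim_unique (explim_log_deriv i C0 random_matrices_add hAB)).
have sA := af2_limA hfree2; have sB := af2_limB hfree2.
have := explim_sum (index_enum 'I_i.+1)
  (fun p : 'I_i.+1 => - (i.+1%:R / p.+1%:R))
  (fun p : 'I_i.+1 => explim_alternating_rv p i.+1).
rewrite big1 => [|p _]; last by rewrite mulr0.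
move/(explimD (explimD (explim_log_deriv i A0 hA sA)
  (explim_log_deriv i B0 hB sB))).
rewrite addr0; apply: eq_explim => N w.
by rewrite (log_deriv_rvD _ (ltnSn i)).
Qed.

Let W0 : W 0 = 0 := pair_product_coef0 CA (alpha P A) CB (alpha P B).

(** The two expansions carry [(i+1)/(p+1)] and [(j+1)/(p+1)], and the covariance carries [p+1]. What
    remains is [(i+1)(j+1)/(p+1)] times a coefficient of [W^(p+1)]: a mixed derivative of
    [- log (1 - W)]. *)
Lemma cov_series_add : cov_series P C AB =
  cov_series P CA A + cov_series P CB B +
  fps_deriv (fps_deriv_y (fps_subst W0 (log_series K))).
Proof.
apply: fpsP => i; apply: fpsP => j.
have sA := af2_limA hfree2; have sB := af2_limB hfree2.
apply: (covlim_unique (covlim_log_deriv i j C0 random_matrices_add hAB)).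
pose m := (maxn i j).+1.
have im : (i < m)%N by rewrite ltnS leq_maxl.
have jm : (j < m)%N by rewrite ltnS leq_maxr.
pose q n N (w : T N) :=
  \sum_(p < m) - (n.+1%:R / p.+1%:R) * alternating_rv p n.+1 w.
have mq n : moments_seq P (q n).
  move=> N; apply: moments_sum => p _; apply: momentsM.
    exact: moments_cst.
  exact: moments_alternating_rv.
have uncor (X : forall N, T N -> K) n' :
    (forall p, covlim P X (alternating_rv p n'.+1) 0) -> covlim P (q n') X 0.
  move=> Xa; have := covlim_suml (index_enum 'I_m)
    (fun p : 'I_m => - (n'.+1%:R / p.+1%:R)) _
    (fun p : 'I_m => covlimC (Xa p)).
  rewrite big1 => [|p _]; last by rewrite mulr0.
  by apply; case: (Xa 0).
have qA n n' := uncor (log_deriv_rv CA A n) n'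
  (fun p => (covlim_log_deriv_alternating p n n'.+1).1).
have qB n n' := uncor (log_deriv_rv CB B n) n'
  (fun p => (covlim_log_deriv_alternating p n n'.+1).2).
have qq := covlim_sum2 (index_enum 'I_m) (index_enum 'I_m)
  (fun p : 'I_m => - (i.+1%:R / p.+1%:R)) (fun p : 'I_m => - (j.+1%:R / p.+1%:R))
  (fun p : 'I_m => moments_alternating_rv p i.+1)
  (fun p : 'I_m => moments_alternating_rv p j.+1)
  (fun p p' : 'I_m => covlim_alternating_rv p p' i.+1 j.+1).
have lA := covlim_log_deriv i j A0 hA sA.
have lB := covlim_log_deriv i j B0 hB sB.
have lAB n n' := covlim_log_derivAB n n'.
(* Nine covariances, grouped by their second argument; all but [lA], [lB] and [qq] have limit
   zero. *)
have cA := covlimD (covlimD lA (covlimC (lAB j i))) (qA j i).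
have cB := covlimD (covlimD (lAB i j) lB) (qB j i).
have cq := covlimD (covlimD (covlimC (qA i j)) (covlimC (qB i j))) qq.
have := covlimC (covlimD (covlimD (covlimC cA) (covlimC cB)) (covlimC cq)).
set l := (X in covlim _ _ _ X); set l' := (X in _ -> covlim _ _ _ X).
suff -> : l = l'.
  by apply: eq_covlim => N w; rewrite (log_deriv_rvD _ (m := m)).
rewrite {}/l {}/l' !fps_coefD !addr0 !add0r; congr (_ + _).
rewrite fps_coef_deriv fps_coefMn fps_coef_map fps_coef_deriv.
rewrite (coef_log_series _ _ im) -!sumrMnl; apply: eq_bigr => p _.
rewrite (bigD1 p) //= eqxx big1 ?addr0 => [|p' /negbTE pp']; last first.
  by rewrite eq_sym -val_eqE in pp'; rewrite pp' mulr0.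
have p0 : p.+1%:R != 0 :> K by rewrite pnatr_eq0.
move: (fps_coef (fps_coef _ _) _) => x.
rewrite -[RHS]mulr_natl -[_ *+ j.+1]mulr_natl.
by field.
Qed.

End FreeSeries.

(** * Second order *)

Section LogPair.
Variable K : numFieldType.
Implicit Types (C : fps K) (al : nat -> K).

Lemma deriv_log_series :
  (1 - fpsX) * fps_deriv (log_series K) = 1.
Proof.
have -> : fps_deriv (log_series K) = FPS (fun=> 1).
  apply: fpsP => n; rewrite fps_coef_deriv.
  rewrite -[log_series K n.+1]/(fpsC (n.+1%:R^-1)) -raddfMn.
  rewrite -[X in _ X = _]mulr_natr mulVf.
    exact: rmorph1.
  by rewrite pnatr_eq0.
apply: fpsP => -[|n]; first by rewrite fps_coef0M fps_coefB subr0 mulr1.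
by rewrite mulrBl mul1r fps_coefB fps_coefXM subrr.
Qed.

Lemma mul_dlog2 (F : fps (fps K)) : F != 0 -> F%:F ^+ 2 * dlog2 F =
  (F * fps_deriv (fps_deriv_y F) - fps_deriv F * fps_deriv_y F)%:F.
Proof.
by rewrite -tofrac_eq0 => F0; rewrite /dlog2 mulrC divfK // expf_neq0.
Qed.

(** Only the differential equation [(1 - w) l_x = w_x] is used: differentiated in [y] and multiplied
    by [1 - w], it yields the numerator of [- dlog2 (1 - w)]. *)
Lemma deriv2_log_series (w : fps (fps K)) (w0 : w 0 = 0) :
  (fps_deriv (fps_deriv_y (fps_subst w0 (log_series K))))%:F = - dlog2 (1 - w).
Proof.
set l := fps_subst w0 _.
have dl : (1 - w) * fps_deriv l = fps_deriv w.
  rewrite fps_deriv_subst mulrA -[X in _ * _ = X]mul1r; congr (_ * _).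
  rewrite -[X in (_ - X) * _](fps_substX w0) -(rmorph1 (fps_subst w0)).
  by rewrite -rmorphB -rmorphM deriv_log_series rmorph1.
have dyl : (1 - w) * fps_deriv (fps_deriv_y l) =
    fps_deriv (fps_deriv_y w) + fps_deriv_y w * fps_deriv l.
  have dy1 : fps_deriv_y (1 : fps (fps K)) = 0.
    by rewrite -(rmorph1 (@fps_inx K)) fps_deriv_y_inx.
  have := congr1 (@fps_deriv_y K) dl.
  rewrite fps_deriv_yM raddfB /= dy1 sub0r -!fps_deriv_xyC => <-.
  by rewrite mulNr addrAC addNr add0r.
have e0 : 1 - w != 0.
  apply/eqP => /(congr1 (fun F : fps (fps K) => F 0)) /eqP.
  by rewrite fps_coefB w0 subr0 oner_eq0.
have key : (1 - w) ^+ 2 * fps_deriv (fps_deriv_y l) =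
    (1 - w) * fps_deriv (fps_deriv_y w) + fps_deriv w * fps_deriv_y w.
  by rewrite expr2 -mulrA dyl -dl mulrDr; congr (_ + _); rewrite mulrCA mulrC.
have f0 : (1 - w)%:F ^+ 2 != 0 by rewrite expf_neq0 // tofrac_eq0.
apply: (mulfI f0); rewrite [RHS]mulrN (mul_dlog2 e0).
rewrite -[X in X * _]tofracXn -[LHS]tofracM key -tofracN; congr tofrac.
have dy1 : fps_deriv_y (1 : fps (fps K)) = 0.
  by rewrite -(rmorph1 (@fps_inx K)) fps_deriv_y_inx.
rewrite [fps_deriv_y (1 - w)]raddfB /= dy1 sub0r.
rewrite [fps_deriv (1 - w)]raddfB /= fps_deriv1 sub0r [fps_deriv (- _)]raddfN /=.
by rewrite mulrN mulrNN opprB opprK addrC.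
Qed.

(** This is [(1 + X) H = t - s]. The series [Z = sum al_(k+l) x^k y^l] satisfies
    [(x - y) Z = x M(x) - y M(y)] by telescoping, and at [x = h(t)], [y = h(s)] the right side
    becomes [t - s]. Centering subtracts [M(x) M(y)], which becomes [C(t) C(s)] and, after division,
    the [1]. *)
Lemma pair_seriesP C al : C 0 = 1 ->
  fps_subst (fps_divX_coef0 C) (series1 al) = C ->
  (pair_series C al + 1) *
    (fps_inx C * fps_iny C * (fps_inx (fpsX / C) - fps_iny (fpsX / C))) =
  fps_inx fpsX - fps_iny fpsX.
Proof.
move=> C0 mC; have CU := fps_unit1 C0.
pose h0 := fps_divX_coef0 C.
pose Z : fps (fps K) := FPS (fun k => FPS (fun l => series1 al (k + l)%N)).
have ZE : (fps_inx fpsX - fps_iny fpsX) * Z =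
    fps_inx (fpsX * series1 al) - fps_iny (fpsX * series1 al).
  rewrite !rmorphM mulrBl; apply: fpsP => k; apply: fpsP => l.
  rewrite !fps_coefB !fps_mulinxX !fps_mulinyX.
  case: k l => [|k] [|l] //=; rewrite ?addn0 ?add0n ?subrr //.
  by rewrite addnS addSn !subrr.
rewrite /pair_series.
have -> : FPS (fun k => FPS (fun l => momcov (series1 al) k l)) =
    Z - fps_inx (series1 al) * fps_iny (series1 al).
  by apply: fpsP => k; apply: fpsP => l; rewrite !fps_coefB fps_coef_inxy.
have sg : fps_subst h0 (fpsX * series1 al) = fpsX.
  by rewrite rmorphM /= fps_substX mC mulrVK.
have sX : fps_subst2 h0 (fps_inx fpsX - fps_iny fpsX) =
    fps_inx (fpsX / C) - fps_iny (fpsX / C).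
  by rewrite rmorphB /= fps_subst2_inx fps_subst2_iny fps_substX.
have sZ : (fps_inx (fpsX / C) - fps_iny (fpsX / C)) * fps_subst2 h0 Z =
    fps_inx fpsX - fps_iny fpsX.
  by rewrite -sX -rmorphM ZE rmorphB /= fps_subst2_inx fps_subst2_iny sg.
have -> : fps_subst2 h0 (Z - fps_inx (series1 al) * fps_iny (series1 al)) =
    fps_subst2 h0 Z - fps_inx C * fps_iny C.
  by rewrite rmorphB rmorphM /= fps_subst2_inx fps_subst2_iny mC.
have ux : fps_inx C^-1 * fps_inx C = 1 by rewrite -rmorphM mulVr // rmorph1.
have uy : fps_iny C^-1 * fps_iny C = 1 by rewrite -rmorphM mulVr // rmorph1.
move: sZ ux uy; move: (fps_inx _ - fps_iny (fpsX / C)) => H.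
move: (fps_inx C^-1) (fps_iny C^-1) (fps_inx C) (fps_iny C) (fps_subst2 _ _).
move=> ix iy Cx Cy SZ <- ux uy.
rewrite [LHS](_ : _ = (ix * Cx) * (iy * Cy) * (H * SZ) -
  (ix * Cx) * (iy * Cy) * (Cx * Cy * H) + Cx * Cy * H); last by ring.
by rewrite ux uy; ring.
Qed.

(** With [d = x - y] and [pa], [pb] such that [(xa + 1) pa = (xb + 1) pb = d],
    one has [(1 - xa xb) pa pb = d (pa + pb - d)], and [pa + pb - d] is the
    analogue of [pa] for the cumulant series [CA + CB - 1] of the sum. *)
Lemma one_sub_pair_product (CA CB : fps K) (al be : nat -> K) :
  CA 0 = 1 -> CB 0 = 1 ->
  fps_subst (fps_divX_coef0 CA) (series1 al) = CA ->
  fps_subst (fps_divX_coef0 CB) (series1 be) = CB ->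
  let C := CA + CB - 1 in
  (1 - pair_series CA al * pair_series CB be) *
    (fps_inx CA * fps_iny CA * (fps_inx (fpsX / CA) - fps_iny (fpsX / CA))) *
    (fps_inx CB * fps_iny CB * (fps_inx (fpsX / CB) - fps_iny (fpsX / CB))) =
  (fps_inx fpsX - fps_iny fpsX) *
    (fps_inx C * fps_iny C * (fps_inx (fpsX / C) - fps_iny (fpsX / C))).
Proof.
move=> A0 B0 mA mB C.
have C0 : C 0 = 1 by rewrite fps_coefB fps_coefD A0 B0 addrK.
(* The form [x D(y) - y D(x)] is affine in [D] with value [x - y] at [D = 1]; for [CA + CB - 1] it
   is therefore the sum of the two values minus [x - y]. *)
have HE (D : fps K) : D 0 = 1 ->
    fps_inx D * fps_iny D * (fps_inx (fpsX / D) - fps_iny (fpsX / D)) =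
    fps_inx fpsX * fps_iny D - fps_iny fpsX * fps_inx D.
  move=> D0; have DU := fps_unit1 D0.
  have hx : fps_inx (fpsX / D) * fps_inx D = fps_inx fpsX.
    by rewrite -rmorphM mulrVK.
  have hy : fps_iny (fpsX / D) * fps_iny D = fps_iny fpsX.
    by rewrite -rmorphM mulrVK.
  by rewrite -hx -hy; ring.
have pA := pair_seriesP A0 mA; have pB := pair_seriesP B0 mB.
rewrite !HE // in pA pB *.
have Cx : fps_inx C = fps_inx CA + fps_inx CB - 1.
  by rewrite rmorphB rmorphD rmorph1.
have Cy : fps_iny C = fps_iny CA + fps_iny CB - 1.
  by rewrite rmorphB rmorphD rmorph1.
rewrite Cx Cy; move: pA pB; move: (pair_series CA al) (pair_series CB be).
move: (fps_inx CA) (fps_inx CB) (fps_iny CA) (fps_iny CB).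
move: (fps_inx fpsX) (fps_iny fpsX) => x y a b a' b' xa xb pA pB.
rewrite [LHS](_ : _ = (x * a' - y * a) * (x * b' - y * b) -
  ((xa + 1) * (x * a' - y * a) - (x * a' - y * a)) *
  ((xb + 1) * (x * b' - y * b) - (x * b' - y * b))); last by ring.
by rewrite pA pB; ring.
Qed.

End LogPair.

Section LogPairProduct.
Variable K : numFieldType.
Implicit Types (C : fps K).

Lemma subxy_divX_neq0 C : C 0 = 1 ->
  fps_inx (fpsX / C) - fps_iny (fpsX / C) != 0.
Proof.
move=> C0; apply: fps_subxy_neq0; exists 1 => //.
by rewrite fps_coefXM fps_inv_coef0 // oner_neq0.
Qed.

Lemma fps_inxy_neq0 C : C 0 = 1 -> fps_inx C * fps_iny C != 0.
Proof.
move=> C0; apply/eqP => /(congr1 (fun F : fps (fps K) => F 0 0)) /eqP.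
by rewrite fps_coef_inxy C0 mulr1 oner_eq0.
Qed.

Lemma dlog2_pencil C : C 0 = 1 ->
  dlog2 (fps_inx C * fps_iny C * (fps_inx (fpsX / C) - fps_iny (fpsX / C))) =
  dlog2 (fps_inx (fpsX / C) - fps_iny (fpsX / C)).
Proof.
move=> C0; rewrite dlog2M ?fps_inxy_neq0 ?subxy_divX_neq0 //.
have := fps_inxy_neq0 C0; rewrite mulf_eq0 negb_or => /andP[Cx Cy].
by rewrite dlog2M // dlog2_inx dlog2_iny !add0r.
Qed.

(** The logarithmic form of [(1 - X Y) HA HB = (t - s) H], with factors in one variable dropped. *)
Lemma dlog2_one_sub_pair (CA CB : fps K) (al be : nat -> K) :
  CA 0 = 1 -> CB 0 = 1 ->
  fps_subst (fps_divX_coef0 CA) (series1 al) = CA ->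
  fps_subst (fps_divX_coef0 CB) (series1 be) = CB ->
  let C := CA + CB - 1 in
  dlog2 (1 - pair_series CA al * pair_series CB be) +
  dlog2 (fps_inx (fpsX / CA) - fps_iny (fpsX / CA)) +
  dlog2 (fps_inx (fpsX / CB) - fps_iny (fpsX / CB)) =
  dlog2 (fps_inx fpsX - fps_iny fpsX) +
  dlog2 (fps_inx (fpsX / C) - fps_iny (fpsX / C)).
Proof.
move=> A0 B0 mA mB C.
have C0 : C 0 = 1 by rewrite fps_coefB fps_coefD A0 B0 addrK.
have e0 : 1 - pair_series CA al * pair_series CB be != 0.
  apply/eqP => /(congr1 (fun F : fps (fps K) => F 0)) /eqP.
  by rewrite fps_coefB pair_product_coef0 subr0 oner_eq0.
have X0 : fps_inx fpsX - fps_iny fpsX != 0 :> fps (fps K).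
  by apply: fps_subxy_neq0; exists 1; rewrite //= oner_neq0.
have n0 (D : fps K) : D 0 = 1 -> fps_inx D * fps_iny D *
    (fps_inx (fpsX / D) - fps_iny (fpsX / D)) != 0.
  by move=> D0; rewrite mulf_neq0 ?fps_inxy_neq0 ?subxy_divX_neq0.
have := congr1 (@dlog2 K) (one_sub_pair_product A0 B0 mA mB).
rewrite -/C (dlog2M (mulf_neq0 e0 (n0 CA A0)) (n0 CB B0)).
rewrite (dlog2M e0 (n0 CA A0)) (dlog2M X0 (n0 C C0)).
by rewrite (dlog2_pencil A0) (dlog2_pencil B0) (dlog2_pencil C0).
Qed.

End LogPairProduct.

Lemma Rtransform2_cov_series (R : realType) (d : nat -> measure_display)
    (T : forall N, measurableType (d N)) (P : forall N, probability (T N) R)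
    (A : ensemble R T) (k : nat -> cplx R) (k2 : nat -> nat -> cplx R) :
  free_cumulants1 (alpha P A) k ->
  free_cumulants2 (alpha P A) (alpha2 P A) k2 ->
  (Rtransform2 k2)%:F = (cov_series P (series1 k) A)%:F
    + dlog2 (fps_inx (fpsX / series1 k) - fps_iny (fpsX / series1 k))
    - dlog2 (fps_inx fpsX - fps_iny fpsX).
Proof. exact: free_cumulants2_subst. Qed.

Theorem theorem2p11 (R : realType) (d : nat -> measure_display)
    (T : forall N, measurableType (d N))
    (P : forall N, probability (T N) R)
    (A B : ensemble R T)
    (hA : random_matrices P A) (hB : random_matrices P B)
    (hfree2 : asymptotically_free2 P A B)
    (hfree : asymptotically_free P A B)
    (huncor : asymptotically_uncorrelated P A B)
    (hAB : second_order_limit P (ensemble_add A B))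
    (kA kB kAB : nat -> cplx R) (kA2 kB2 kAB2 : nat -> nat -> cplx R)
    (hkA : free_cumulants1 (alpha P A) kA)
    (hkB : free_cumulants1 (alpha P B) kB)
    (hkAB : free_cumulants1 (alpha P (ensemble_add A B)) kAB)
    (hkA2 : free_cumulants2 (alpha P A) (alpha2 P A) kA2)
    (hkB2 : free_cumulants2 (alpha P B) (alpha2 P B) kB2)
    (hkAB2 : free_cumulants2 (alpha P (ensemble_add A B))
               (alpha2 P (ensemble_add A B)) kAB2) :
  [/\ forall n, (1 <= n)%N -> kAB n = kA n + kB n,
      forall m n, (1 <= m)%N -> (1 <= n)%N -> kAB2 m n = kA2 m n + kB2 m n,
      Rtransform1 kAB = Rtransform1 kA + Rtransform1 kB
    & Rtransform2 kAB2 = Rtransform2 kA2 + Rtransform2 kB2].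
Proof.
(* Here [u], [v] stand for the covariance series, [e] for the term of [1 - X Y], [a], [b], [c] for
   those of the three differences [h(t) - h(s)], and [x] for that of [t - s]. *)
have rearrange (F : fieldType) (u v e a b x c : F) : e + a + b = x + c ->
    u + v - e + c - x = u + a - x + (v + b - x).
  by move=> /(canRL (addrK _)) /(canRL (addrK _)) ->; ring.
have c0 (k : nat -> cplx R) : series1 k 0 = 1 by [].
have mA := fps_subst_divX_moment (c0 kA) (c0 (alpha P A)) hkA.
have mB := fps_subst_divX_moment (c0 kB) (c0 (alpha P B)) hkB.
(* The relation [M(x / C) = C] determines the cumulant series, and [CA + CB - 1] satisfies it for
   the moments of the sum. *)
have CE : series1 kAB = series1 kA + series1 kB - 1.
  apply: (fps_subst_divX_uniq (c0 kAB) _ _ hkAB) => //.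
    by rewrite fps_coefB fps_coefD !c0 addrK.
  exact: moment_series_add.
have k1 n : kAB n.+1 = kA n.+1 + kB n.+1.
  have := congr1 (fun f : fps (cplx R) => f n.+1) CE.
  by rewrite fps_coefB fps_coefD subr0.
have R2 : Rtransform2 kAB2 = Rtransform2 kA2 + Rtransform2 kB2.
  apply/eqP; rewrite -tofrac_eq; apply/eqP; rewrite tofracD.
  rewrite (Rtransform2_cov_series hkA hkA2) (Rtransform2_cov_series hkB hkB2).
  rewrite (Rtransform2_cov_series hkAB hkAB2) CE.
  have -> := cov_series_add hA hB hfree2 hfree huncor (c0 kA) (c0 kB) mA mB hAB.
  rewrite !tofracD deriv2_log_series.
  apply: rearrange; exact: (dlog2_one_sub_pair (c0 kA) (c0 kB) mA mB).
split; [by case=> // n _; apply: k1 | | | exact: R2]; last first.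
  by apply: fpsP => n; apply: k1.
case=> [//|m] [//|n] _ _.
exact: (congr1 (fun F : fps (fps (cplx R)) => F m n) R2).
Qed.
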